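(* Let $\varphi_\alpha(z) = z_1^2 + \alpha z_1 z_2 + z_2^2$ for $\alpha\geq 0$. Then the following are optimal weak factorizations of $\varphi_\alpha$ in $H^2(\mathbb{T}^2)\odot H^2(\mathbb{T}^2)$: (i) If $0 \leq \alpha \leq 1/2$, then an optimal weak factorization is $\varphi_\alpha = \varphi_\alpha \cdot 1$. (ii) If $1/2<\alpha<2$, then an optimal weak factorization is \[\varphi_\alpha(z) = \frac{2}{3}(\alpha-1/2) (z_1+z_2)(z_1+z_2) + \frac{2}{3}(2-\alpha) \left(z_1^2+\frac{z_1z_2}{2}+z_2^2\right) \cdot 1.\] (iii) If $\alpha>2$, then an optimal weak factorization is \[\varphi_\alpha(z) = \left(z_1 + \frac{\alpha+\sqrt{\alpha^2-4}}{2} z_2\right)\left(z_1 + \frac{\alpha-\sqrt{\alpha^2-4}}{2} z_2\right).\]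
   Context: $\mathbb{T}$ is the unit circle in the complex plane, and $\mathbb{T}^2$ carries the product of normalized Lebesgue arc length measures. The Hardy space $H^2(\mathbb{T}^2)$ is the closure in $L^2(\mathbb{T}^2)$ of the set of polynomials in two complex variables, with the $L^2$ norm; its elements are identified in the usual way with their holomorphic extensions to the polydisc $\mathbb{D}^2$. The weak product space $H^2(\mathbb{T}^2)\odot H^2(\mathbb{T}^2)$ is the Banach space of all functions $f$ (on $\mathbb{D}^2$) that have a weak factorization $f = \sum_{j=1}^\infty g_j h_j$ with $g_j,h_j$ in $H^2(\mathbb{T}^2)$ and $\sum_{j=1}^\infty \|g_j\|_{H^2(\mathbb{T}^2)}\|h_j\|_{H^2(\mathbb{T}^2)}<\infty$; its norm is the infimum of the latter sum over all weak factorizations of $f$. A weak factorization of $f$ is called optimal if $\sum_{j} \|g_j\|_{H^2(\mathbb{T}^2)}\|h_j\|_{H^2(\mathbb{T}^2)}$ attains this infimum. Finite sums are regarded as weak factorizations with all remaining terms zero. In (ii), the two displayed summands are the two terms of the weak factorization, with the nonnegative scalar coefficients absorbed into one of the factors. *)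

(* Defs.v *)
From HB Require Import structures.
From mathcomp Require Export all_boot all_order all_algebra.
From mathcomp Require Export complex.
From mathcomp Require Export all_classical all_reals all_analysis.
Export Order.TTheory GRing.Theory Num.Theory numFieldNormedType.Exports.

Set Implicit Arguments.
Unset Strict Implicit.
Unset Printing Implicit Defensive.

Local Open Scope classical_set_scope.
Local Open Scope ring_scope.
Local Open Scope complex_scope.

Section Torus.
Context {R : realType}.
Notation C := R[i].
Notation mu := (@lebesgue_measure R).

Definition in_bidisc (z1 z2 : C) : Prop := Normc.normc z1 < 1 /\ Normc.normc z2 < 1.

(* t |-> exp(2 i pi t) carries Lebesgue measure on [0, 1] to the normalized
   arc length measure of the unit circle, so integrals over the torus are
   written as integrals over the unit square. *)
Definition circ (t : R) : C := cos (2 * pi * t) +i* sin (2 * pi * t).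

Definition square : set (R * R) := `[0, 1] `*` `[0, 1].

(* A function on the torus is given by a total function C -> C -> C, of which
   only the values at points (circ s, circ t) matter. *)
Definition angular (f : C -> C -> C) (x : R * R) : C :=
  f (circ x.1) (circ x.2).

Definition sqr_integral (f : C -> C -> C) : \bar R :=
  (\int[(mu \x mu)%E]_(x in square) ((Normc.normc (angular f x) ^+ 2)%:E))%E.

Definition in_L2 (f : C -> C -> C) : Prop :=
  [/\ measurable_fun square (fun x => complex.Re (angular f x)),
      measurable_fun square (fun x => complex.Im (angular f x)) &
      (sqr_integral f < +oo)%E].

Definition L2norm (f : C -> C -> C) : R := Num.sqrt (fine (sqr_integral f)).

(* The outer variable of p is z2. *)
Definition poly2 (p : {poly {poly C}}) (z1 z2 : C) : C := p.[z2%:P].[z1].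

Definition in_H2 (f : C -> C -> C) : Prop :=
  in_L2 f /\
  forall e : R, 0 < e ->
    exists p : {poly {poly C}}, L2norm (fun w1 w2 => f w1 w2 - poly2 p w1 w2) < e.

Definition poisson_kernel (z w : C) : R :=
  (1 - Normc.normc z ^+ 2) / Normc.normc (w - z) ^+ 2.

(* The extension of f to the bidisc, as its Poisson integral. *)
Definition extension (f : C -> C -> C) (z1 z2 : C) : C :=
  (\int[(mu \x mu)%E]_(x in square)
     (poisson_kernel z1 (circ x.1) * poisson_kernel z2 (circ x.2)
      * complex.Re (angular f x)))
  +i*
  (\int[(mu \x mu)%E]_(x in square)
     (poisson_kernel z1 (circ x.1) * poisson_kernel z2 (circ x.2)
      * complex.Im (angular f x))).

Definition cost (g h : nat -> C -> C -> C) : \bar R :=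
  (\sum_(0 <= j <oo) (L2norm (g j) * L2norm (h j))%:E)%E.

(* Here f is a function on the bidisc, while the g j and h j are elements of
   H^2 given by their boundary values on the torus. *)
Definition weak_factorization (f : C -> C -> C) (g h : nat -> C -> C -> C) :
    Prop :=
  [/\ forall j, in_H2 (g j),
      forall j, in_H2 (h j),
      (cost g h < +oo)%E &
      forall z1 z2, in_bidisc z1 z2 ->
        (fun n => Normc.normc
           (\sum_(0 <= j < n) extension (g j) z1 z2 * extension (h j) z1 z2
            - f z1 z2)) @ \oo --> (0 : R)].

Definition weak_product_norm (f : C -> C -> C) : \bar R :=
  ereal_inf [set c | exists g h, weak_factorization f g h /\ c = cost g h].

Definition optimal (f : C -> C -> C) (g h : nat -> C -> C -> C) : Prop :=
  weak_factorization f g h /\ cost g h = weak_product_norm f.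

(* The finite family s, continued by zero. *)
Definition finite_family (s : seq (C -> C -> C)) (j : nat) : C -> C -> C :=
  nth (fun _ _ => 0) s j.

Definition phi (a : R) (z1 z2 : C) : C :=
  z1 ^+ 2 + a%:C * z1 * z2 + z2 ^+ 2.

End Torus.

(* Main.v *)
Require Import Defs.
From mathcomp Require Import measurable_realfun ring lra.

(** The optimality of each factorization is proved by duality.  For [f]
holomorphic on the bidisc with Taylor coefficients [f_mn] and for [A], [B]
nonnegative, put [Lambda f = A (f_20 + f_02) + B f_11].  The bilinear form
[(g, h) |-> Lambda (g h)] on the Hardy space is a Hankel form: it pairs the
constant term of one factor with the second-degree coefficients of the other
through the vector [(A, B, A)], and the first-degree coefficients with each
other through the symmetric matrix with [A] on the diagonal and [B] off it.
Its norm is therefore the larger of [sqrt (2 A^2 + B^2)] and [A + B]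
([hankel_bound]).  When both are at most [1], a weak factorization of [phi a]
costs at least [Lambda (phi a) = 2 A + B a] ([le_cost_phi]).  The choices
[(A, B) = (1, a) / sqrt (2 + a^2)], [(2/3, 1/3)] and [(0, 1)] give the cost of
the factorization proposed for small, intermediate and large [a]; these costs
are computed with Parseval's identity ([L2norm_tpoly]).

A weak factorization converges only pointwise, so [Lambda] is replaced by a
combination of second difference quotients [secdiff] that evaluates a function
at the nine points of [{0, r, -r}^2].  Three facts make it a substitute for
[Lambda].  On a product of two polynomials it is bounded by [1 + O(r)] times
the product of their norms, with a constant independent of the degrees
([secdiff_tpoly]): the terms of degree at most two contribute the Hankel form
up to [O(r^2)], the remaining ones contribute [O(r)].  The value of the Poisson
extension at a point is continuous for the [L^2] norm ([extension_close]), so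
the bound passes from polynomials to the Hardy space ([secdiff_H2]).  Finally
[secdiff] commutes with pointwise limits, and it takes on [phi a] the value
[2 A + B a] for all positive [r], so that [r] can tend to [0].

That the Poisson extension of a polynomial is the polynomial itself
([extension_tpoly]) reduces, by Fubini's theorem, to the moments of the Poisson
kernel on the circle ([poisson_momentE]). *)

Set Implicit Arguments.
Unset Strict Implicit.
Unset Printing Implicit Defensive.

Local Open Scope classical_set_scope.
Local Open Scope ring_scope.
Local Open Scope complex_scope.

(** * Complex modulus, bounded measurable functions and characters of the circle *)

Notation cmod := Normc.normc.

Section Modulus.
Context {R : realType}.
Implicit Types (x : R) (z w : R[i]).

Lemma cmod_ge0 z : 0 <= cmod z.
Proof. by case: z => a b; rewrite /cmod sqrtr_ge0. Qed.

Lemma sqr_cmod z : cmod z ^+ 2 = complex.Re z ^+ 2 + complex.Im z ^+ 2.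
Proof. by case: z => a b; rewrite /cmod sqr_sqrtr// addr_ge0 ?sqr_ge0. Qed.

Lemma cmodD z w : cmod (z + w) <= cmod z + cmod w.
Proof. exact: (le_normcD (z : Rcomplex R)). Qed.

Lemma cmodN z : cmod (- z) = cmod z.
Proof. exact: (normcN (z : Rcomplex R)). Qed.

Lemma cmodB z w : cmod (z - w) <= cmod z + cmod w.
Proof. by rewrite -(cmodN w) cmodD. Qed.

Lemma cmod_real x : cmod x%:C = `|x|.
Proof. by rewrite /cmod /= expr0n addr0 sqrtr_sqr. Qed.

Lemma cmodX z n : cmod (z ^+ n) = cmod z ^+ n.
Proof.
by elim: n => [|n IH]; rewrite ?expr0 ?Normc.normc1// !exprS Normc.normcM IH.
Qed.

Lemma cmod_sum (I : Type) (r : seq I) (P : pred I) (F : I -> R[i]) :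
  cmod (\sum_(i <- r | P i) F i) <= \sum_(i <- r | P i) cmod (F i).
Proof.
apply: (big_ind2 (fun z x => cmod z <= x)) => //; first by rewrite Normc.normc0.
by move=> z x w y zx wy; apply: le_trans (cmodD _ _) (lerD zx wy).
Qed.

Lemma cmod_conj z : cmod (conjc z) = cmod z.
Proof. by case: z => a b; rewrite /cmod /= sqrrN. Qed.

Lemma Re_le_cmod z : `|complex.Re z| <= cmod z.
Proof.
rewrite -(@ler_pXn2r _ 2%N)// ?nnegrE ?cmod_ge0// sqr_cmod real_normK ?num_real//.
by rewrite lerDl sqr_ge0.
Qed.

Lemma Im_le_cmod z : `|complex.Im z| <= cmod z.
Proof.
rewrite -(@ler_pXn2r _ 2%N)// ?nnegrE ?cmod_ge0// sqr_cmod real_normK ?num_real//.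
by rewrite lerDr sqr_ge0.
Qed.

Lemma cmod_le_ReIm z : cmod z <= `|complex.Re z| + `|complex.Im z|.
Proof.
rewrite -(@ler_pXn2r _ 2%N)// ?nnegrE ?cmod_ge0 ?addr_ge0// sqr_cmod sqrrD.
by rewrite !real_normK ?num_real// addrAC lerDl mulrn_wge0 ?mulr_ge0.
Qed.

Lemma mul_conjc z : z * conjc z = (cmod z ^+ 2)%:C.
Proof. by rewrite sqr_cmod; case: z => a b; simpc; congr (_ +i* _); ring. Qed.

End Modulus.

Section BoundedMeasurable.
Context {R : realType} {d : measure_display} {T : measurableType d}.
Implicit Types F G : T -> R[i].

Definition bounded_measurable F : Prop :=
  [/\ measurable_fun setT (fun x => complex.Re (F x)),
      measurable_fun setT (fun x => complex.Im (F x)) &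
      exists b : R, forall x, cmod (F x) <= b].

Lemma bm_cst (c : R[i]) : bounded_measurable (fun=> c).
Proof. by split; [exact: measurable_cst..|exists (cmod c)]. Qed.

Lemma bmD F G : bounded_measurable F -> bounded_measurable G ->
  bounded_measurable (fun x => F x + G x).
Proof.
move=> [mF mF' [a Fa]] [mG mG' [b Gb]]; split.
- rewrite (_ : (fun _ => _) = (fun x => complex.Re (F x) + complex.Re (G x))).
    exact: measurable_funD.
  by apply/funext => x; case: (F x) (G x) => ? ? [].
- rewrite (_ : (fun _ => _) = (fun x => complex.Im (F x) + complex.Im (G x))).
    exact: measurable_funD.
  by apply/funext => x; case: (F x) (G x) => ? ? [].
- by exists (a + b) => x; apply: le_trans (cmodD _ _) (lerD (Fa x) (Gb x)).
Qed.

Lemma bmM F G : bounded_measurable F -> bounded_measurable G ->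
  bounded_measurable (fun x => F x * G x).
Proof.
move=> [mF mF' [a Fa]] [mG mG' [b Gb]]; split.
- rewrite (_ : (fun _ => _) = (fun x => complex.Re (F x) * complex.Re (G x)
     - complex.Im (F x) * complex.Im (G x))).
    by apply: measurable_funB; exact: measurable_funM.
  by apply/funext => x; case: (F x) (G x) => ? ? [].
- rewrite (_ : (fun _ => _) = (fun x => complex.Re (F x) * complex.Im (G x)
     + complex.Im (F x) * complex.Re (G x))).
    by apply: measurable_funD; exact: measurable_funM.
  by apply/funext => x; case: (F x) (G x) => ? ? [].
- exists (a * b) => x; rewrite Normc.normcM.
  by apply: ler_pM (cmod_ge0 _) (cmod_ge0 _) (Fa x) (Gb x).
Qed.

Lemma bm_sum (I : Type) (r : seq I) (P : pred I) (F : I -> T -> R[i]) :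
  (forall i, bounded_measurable (F i)) ->
  bounded_measurable (fun x => \sum_(i <- r | P i) F i x).
Proof.
move=> bF; elim: r => [|i r IH].
  by under eq_fun do rewrite big_nil; exact: bm_cst.
under eq_fun do rewrite big_cons.
by case: (P i) => //; apply: bmD.
Qed.

Lemma bm_real (u : T -> R) (b : R) : measurable_fun setT u ->
  (forall x, `|u x| <= b) -> bounded_measurable (fun x => (u x)%:C).
Proof.
move=> mu ub; split; [exact: mu|exact: measurable_cst|].
by exists b => x; rewrite cmod_real.
Qed.

End BoundedMeasurable.

Lemma bm_comp {R : realType} {d d' : measure_display} {T : measurableType d}
    {T' : measurableType d'} (F : T' -> R[i]) (p : T -> T') :
  measurable_fun setT p -> bounded_measurable F ->
  bounded_measurable (fun x => F (p x)).
Proof.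
move=> mp [mF mF' [b Fb]]; split; last by exists b.
- exact: (measurableT_comp mF).
- exact: (measurableT_comp mF').
Qed.

Section Characters.
Context {R : realType}.
Implicit Types (s t : R) (k l : int).

Lemma circD s t : circ (s + t) = circ s * circ t.
Proof.
by rewrite /circ mulrDr cosD sinD; simpc; congr (_ +i* _); ring.
Qed.

Lemma circ0 : circ (0 : R) = 1.
Proof. by rewrite /circ mulr0 cos0 sin0. Qed.

Lemma circN t : circ (- t) = conjc (circ t).
Proof. by rewrite /circ mulrN cosN sinN. Qed.

Lemma cmod_circ t : cmod (circ t) = 1.
Proof.
apply/eqP; rewrite -(@eqrXn2 _ 2%N)// ?cmod_ge0// expr1n sqr_cmod/=.
by rewrite cos2Dsin2.
Qed.

Definition char k t : R[i] := circ (k%:~R * t).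

Lemma char0 t : char 0 t = 1.
Proof. by rewrite /char mul0r circ0. Qed.

Lemma charD k l t : char (k + l) t = char k t * char l t.
Proof. by rewrite /char rmorphD/= mulrDl circD. Qed.

Lemma charN k t : char (- k) t = conjc (char k t).
Proof. by rewrite /char rmorphN/= mulNr circN. Qed.

Lemma char1 t : char 1 t = circ t.
Proof. by rewrite /char mul1r. Qed.

Lemma circX t n : circ t ^+ n = char n%:Z t.
Proof.
elim: n => [|n IH]; first by rewrite char0.
by rewrite exprS IH -addn1 PoszD addrC charD char1.
Qed.

(** Integrality of the frequency enters here: the characters have period [1], which
makes their integrals over the unit interval vanish
except at the frequency [0]. *)
Lemma char_period k : char k (1 : R) = 1.
Proof.
have circ1 : circ (1 : R) = 1.
  by rewrite /circ mulr1 mulr_natl cos2pi sin2pi.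
have char_nat n : char n%:Z (1 : R) = 1 by rewrite -circX circ1 expr1n.
case: k => n //; rewrite NegzE charN char_nat; exact: rmorph1.
Qed.


Lemma is_derive_linear (c t : R) : is_derive t (1 : R) (fun s => c * s) c.
Proof.
have : is_derive t (1 : R) (c \*: (@id R)) (c *: 1).
  by apply: is_deriveZ.
by rewrite /GRing.scale/= mulr1.
Qed.

Lemma derivative_Im_char k t :
  is_derive t (1 : R) (fun s => complex.Im (char k s))
    (2 * pi * k%:~R * complex.Re (char k t)).
Proof.
rewrite /char /circ /=.
rewrite (_ : (fun s => _) = sin \o (fun s => (2 * pi * k%:~R) * s)); last first.
  by apply/funext => s /=; rewrite mulrA.
have dl := is_derive_linear (2 * pi * k%:~R) t.
by apply: is_derive_eq; rewrite [in RHS]mulrA; ring.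
Qed.

Lemma derivative_Re_char k t :
  is_derive t (1 : R) (fun s => complex.Re (char k s))
    (- (2 * pi * k%:~R) * complex.Im (char k t)).
Proof.
rewrite /char /circ /=.
rewrite (_ : (fun s => _) = cos \o (fun s => (2 * pi * k%:~R) * s)); last first.
  by apply/funext => s /=; rewrite mulrA.
have dl := is_derive_linear (2 * pi * k%:~R) t.
by apply: is_derive_eq; rewrite [in RHS]mulrA; ring.
Qed.

Lemma continuous_Re_char k : continuous (fun t : R => complex.Re (char k t)).
Proof.
move=> t; apply: differentiable_continuous; apply/derivable1_diffP.
by have [] := derivative_Re_char k t.
Qed.

Lemma continuous_Im_char k : continuous (fun t : R => complex.Im (char k t)).
Proof.
move=> t; apply: differentiable_continuous; apply/derivable1_diffP.
by have [] := derivative_Im_char k t.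
Qed.

Lemma FTC_01 (f F : R -> R) : continuous f -> (forall t, is_derive t (1 : R) F (f t)) ->
  \int[@lebesgue_measure R]_(t in `[0, 1]) f t = F 1 - F 0.
Proof.
move=> cf dF; rewrite /Rintegral (@continuous_FTC2 _ f F)//.
- exact: continuous_subspaceT.
- split=> [x _||].
  + by have [] := dF x.
  + apply: cvg_at_right_filter; apply: differentiable_continuous.
    by apply/derivable1_diffP; have [] := dF 0.
  + apply: cvg_at_left_filter; apply: differentiable_continuous.
    by apply/derivable1_diffP; have [] := dF 1.
- by move=> x _; rewrite derive1E; have [] := dF x.
Qed.

Lemma integral_Re_char k : k != 0 ->
  \int[@lebesgue_measure R]_(t in `[0, 1]) complex.Re (char k t) = 0.
Proof.
move=> k0; set c : R := 2 * pi * k%:~R.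
have c0 : c != 0 by rewrite ?oppr_eq0 !mulf_neq0 ?intr_eq0// gt_eqF ?pi_gt0.
have dF t : is_derive t (1 : R) (c^-1 \*: (fun t => complex.Im (char k t)))
    (complex.Re (char k t)).
  have dc := derivative_Im_char k t.
  by apply: is_derive_eq; rewrite /GRing.scale/= mulKf.
rewrite (FTC_01 (@continuous_Re_char k) dF) /GRing.scale_fun.
by rewrite char_period /char mulr0 circ0 subrr.
Qed.

Lemma integral_Im_char k : k != 0 ->
  \int[@lebesgue_measure R]_(t in `[0, 1]) complex.Im (char k t) = 0.
Proof.
move=> k0; set c : R := - (2 * pi * k%:~R).
have c0 : c != 0 by rewrite ?oppr_eq0 !mulf_neq0 ?intr_eq0// gt_eqF ?pi_gt0.
have dF t : is_derive t (1 : R) (c^-1 \*: (fun t => complex.Re (char k t)))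
    (complex.Im (char k t)).
  have dc := derivative_Re_char k t.
  by apply: is_derive_eq; rewrite /GRing.scale/= mulKf.
rewrite (FTC_01 (@continuous_Im_char k) dF) /GRing.scale_fun.
by rewrite char_period /char mulr0 circ0 subrr.
Qed.

Lemma bm_char k : bounded_measurable (char k : R -> _).
Proof.
split; last by exists 1 => t; rewrite cmod_circ.
- apply: continuous_measurable_fun; exact: continuous_Re_char.
- apply: continuous_measurable_fun; exact: continuous_Im_char.
Qed.

End Characters.

(** * Integration of complex-valued functions *)

Section ComplexIntegral.
Context {R : realType} {d : measure_display} {T : measurableType d}.
Context (mu : {measure set T -> \bar R}) (D : set T).
Hypotheses (mD : measurable D) (muD : mu D = 1%E).
Implicit Types (u : T -> R) (F G : T -> R[i]).

Lemma integrable_bounded u (b : R) : measurable_fun setT u ->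
  (forall x, `|u x| <= b) -> mu.-integrable D (EFin \o u).
Proof.
move=> mu_ ub; apply: measurable_bounded_integrable => //.
- by rewrite muD ltry.
- exact: measurable_funTS.
- exists b; split; first exact: num_real.
  by move=> x bx y _ /=; exact: le_trans (ub y) (ltW bx).
Qed.

Lemma integrable_bounded_mul (h : T -> R) u (b : R) : measurable_fun setT h ->
  (forall x, `|h x| <= b) -> mu.-integrable D (EFin \o u) ->
  mu.-integrable D (EFin \o (fun x => h x * u x)).
Proof.
move=> mh hb iu.
suff : mu.-integrable D ((EFin \o h) \* (EFin \o u))%E by [].
apply: integrableMr => //; first exact: measurable_funTS.
exists b; split; first exact: num_real.
by move=> x bx y _ /=; exact: le_trans (hb y) (ltW bx).
Qed.

Lemma integrable_scale (a : R) u : mu.-integrable D (EFin \o u) ->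
  mu.-integrable D (EFin \o (fun x => a * u x)).
Proof.
by move=> iu; apply: (integrable_bounded_mul (b := `|a|)) => //; exact: measurable_cst.
Qed.

Definition cintegrable F :=
  mu.-integrable D (EFin \o (fun x => complex.Re (F x))) /\
  mu.-integrable D (EFin \o (fun x => complex.Im (F x))).

Definition cint F : R[i] :=
  (\int[mu]_(x in D) complex.Re (F x)) +i* (\int[mu]_(x in D) complex.Im (F x)).

Lemma bm_cintegrable F : bounded_measurable F -> cintegrable F.
Proof.
move=> [mF mF' [b Fb]]; split.
- by apply: (integrable_bounded (b := b)) => // x; apply: le_trans (Re_le_cmod _) _.
- by apply: (integrable_bounded (b := b)) => // x; apply: le_trans (Im_le_cmod _) _.
Qed.

Lemma cintD F G : cintegrable F -> cintegrable G ->
  cint (fun x => F x + G x) = cint F + cint G.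
Proof.
move=> [iF iF'] [iG iG']; rewrite /cint.
under eq_Rintegral do rewrite raddfD/=.
under [X in _ +i* X]eq_Rintegral do rewrite raddfD/=.
by rewrite !RintegralD.
Qed.

Lemma cintZ (c : R[i]) F : cintegrable F -> cint (fun x => c * F x) = c * cint F.
Proof.
case: c => a b [iF iF']; rewrite /cint.
rewrite (_ : Rintegral _ _ _ = \int[mu]_(x in D)
    (a * complex.Re (F x) - b * complex.Im (F x))); last first.
  by apply: eq_Rintegral => x _; case: (F x).
rewrite [X in _ +i* X](_ : _ = \int[mu]_(x in D)
    (a * complex.Im (F x) + b * complex.Re (F x))); last first.
  by apply: eq_Rintegral => x _; case: (F x) => ? ? /=.
by rewrite RintegralB ?RintegralD ?RintegralZl//; exact: integrable_scale.
Qed.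

Lemma cint_cst c : cint (fun=> c) = c.
Proof. by case: c => a b; rewrite /cint !Rintegral_cst// muD /= !mulr1. Qed.

Lemma cint_sum (I : Type) (r : seq I) (P : pred I) (F : I -> T -> R[i]) :
  (forall i, bounded_measurable (F i)) ->
  cint (fun x => \sum_(i <- r | P i) F i x) = \sum_(i <- r | P i) cint (F i).
Proof.
move=> bF; elim: r => [|i r IH].
  by under eq_fun do rewrite big_nil; rewrite cint_cst big_nil.
under eq_fun do rewrite big_cons; rewrite big_cons.
case: (P i) => //.
by rewrite cintD ?IH//; apply: bm_cintegrable => //; exact: bm_sum.
Qed.

Lemma Rintegral_bound u (b : R) : mu.-integrable D (EFin \o u) ->
  (forall x, `|u x| <= b) -> `|\int[mu]_(x in D) u x| <= b.
Proof.
move=> iu ub; apply: le_trans (le_normr_Rintegral mD iu) _.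
have -> : b = \int[mu]_(x in D) (fun=> b) x by rewrite Rintegral_cst// muD mulr1.
apply: le_Rintegral => //; first exact: integrable_norm.
by apply: (integrable_bounded (b := `|b|)) => //; exact: measurable_cst.
Qed.

Lemma cint_bound F (b : R) : bounded_measurable F ->
  (forall x, cmod (F x) <= b) -> cmod (cint F) <= b *+ 2.
Proof.
move=> bF Fb; have [iF iF'] := bm_cintegrable bF.
apply: le_trans (cmod_le_ReIm _) _; rewrite mulr2n lerD//=.
- by apply: Rintegral_bound => // x; apply: le_trans (Re_le_cmod _) _.
- by apply: Rintegral_bound => // x; apply: le_trans (Im_le_cmod _) _.
Qed.

End ComplexIntegral.

Section ProductIntegral.
Context {R : realType} {d1 d2 : measure_display}.
Context {T1 : measurableType d1} {T2 : measurableType d2}.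
Context (m1 : {sigma_finite_measure set T1 -> \bar R}).
Context (m2 : {sigma_finite_measure set T2 -> \bar R}).
Context (D1 : set T1) (D2 : set T2).
Hypotheses (mD1 : measurable D1) (mD2 : measurable D2).
Hypotheses (m1D : m1 D1 = 1%E) (m2D : m2 D2 = 1%E).
Local Notation m12 := (m1 \x m2)%E.

Let mD : measurable (D1 `*` D2). Proof. exact: measurableX. Qed.

Lemma measure_setX1 : m12 (D1 `*` D2) = 1%E.
Proof.
transitivity (m1 D1 * m2 D2)%E; first exact: product_measure1E.
by rewrite m1D m2D mule1.
Qed.

Lemma integrable_tensor (u : T1 -> R) (v : T2 -> R) (a b : R) :
  measurable_fun setT u -> measurable_fun setT v ->
  (forall t, `|u t| <= a) -> (forall t, `|v t| <= b) ->
  m12.-integrable (D1 `*` D2) (EFin \o (fun x => u x.1 * v x.2)).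
Proof.
move=> mu_ mv ua vb.
apply: (@integrable_bounded R _ _ m12 _ mD measure_setX1
  (fun x => u x.1 * v x.2) (a * b)).
- apply: measurable_funM; first exact: measurableT_comp mu_ _.
  exact: measurableT_comp mv _.
- by move=> x; rewrite normrM ler_pM.
Qed.

Lemma Rintegral_tensor (u : T1 -> R) (v : T2 -> R) (a b : R) :
  measurable_fun setT u -> measurable_fun setT v ->
  (forall t, `|u t| <= a) -> (forall t, `|v t| <= b) ->
  \int[m12]_(x in D1 `*` D2) (u x.1 * v x.2) =
  \int[m1]_(t in D1) u t * \int[m2]_(t in D2) v t.
Proof.
move=> mu_ mv ua vb.
have iu := integrable_bounded mD1 m1D mu_ ua.
have iv := integrable_bounded mD2 m2D mv vb.
have iuv := integrable_tensor mu_ mv ua vb.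
have fu := integrable_fin_num mD1 iu.
have fv := integrable_fin_num mD2 iv.
have fuv := integrable_fin_num mD iuv.
apply: EFin_inj; rewrite EFinM /Rintegral (fineK fu) (fineK fv) (fineK fuv).
rewrite integral_mkcond -integral12_prod_meas1/=; last first.
  exact/(integrable_mkcond _ mD).
pose uI := (EFin \o u) \_ D1; pose vI := (EFin \o v) \_ D2.
have iuI : m1.-integrable setT uI by exact/(integrable_mkcond _ mD1).
have ivI : m2.-integrable setT vI by exact/(integrable_mkcond _ mD2).
have Ev : (\int[m2]_(t in D2) (v t)%:E = \int[m2]_t vI t)%E.
  by rewrite integral_mkcond.
have Eu : (\int[m1]_(t in D1) (u t)%:E = \int[m1]_t uI t)%E.
  by rewrite integral_mkcond.
rewrite Eu Ev; have fvI : (\int[m2]_t vI t)%E \is a fin_num by rewrite -Ev.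
transitivity (\int[m1]_x ((\int[m2]_t vI t) * uI x))%E; last first.
  by rewrite -(fineK fvI) integralZl// muleC.
apply: eq_integral => x _; rewrite /fubini_F.
have fx : uI x \is a fin_num by rewrite /uI patchE; case: ifP.
rewrite muleC -(fineK fx) -integralZl//.
apply: eq_integral => y _; rewrite (fineK fx) /uI /vI !patchE /= in_setX /=.
by case: (x \in _); case: (y \in _); rewrite /= ?mul0e ?mule0 ?EFinM.
Qed.

(** Fubini's theorem for complex tensor products, from the four real products of
real and imaginary parts. *)
Lemma cint_tensor (F : T1 -> R[i]) (G : T2 -> R[i]) :
  bounded_measurable F -> bounded_measurable G ->
  cint m12 (D1 `*` D2) (fun x => F x.1 * G x.2) = cint m1 D1 F * cint m2 D2 G.
Proof.
move=> [mF mF' [a Fa]] [mG mG' [b Gb]].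
have ReF t : `|complex.Re (F t)| <= a by apply: le_trans (Re_le_cmod _) _.
have ImF t : `|complex.Im (F t)| <= a by apply: le_trans (Im_le_cmod _) _.
have ReG t : `|complex.Re (G t)| <= b by apply: le_trans (Re_le_cmod _) _.
have ImG t : `|complex.Im (G t)| <= b by apply: le_trans (Im_le_cmod _) _.
rewrite /cint.
rewrite (_ : Rintegral _ _ _ = \int[m12]_(x in D1 `*` D2)
    (complex.Re (F x.1) * complex.Re (G x.2)
     - complex.Im (F x.1) * complex.Im (G x.2))); last first.
  by apply: eq_Rintegral => x _; case: (F x.1) (G x.2) => ? ? [].
rewrite [X in _ +i* X = _](_ : _ = \int[m12]_(x in D1 `*` D2)
    (complex.Re (F x.1) * complex.Im (G x.2)
     + complex.Im (F x.1) * complex.Re (G x.2))); last first.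
  by apply: eq_Rintegral => x _; case: (F x.1) (G x.2) => ? ? [].
rewrite RintegralB//; [|exact: integrable_tensor ReF ReG
  |exact: integrable_tensor ImF ImG].
rewrite RintegralD//; [|exact: integrable_tensor ReF ImG
  |exact: integrable_tensor ImF ReG].
rewrite (Rintegral_tensor mF mG ReF ReG) (Rintegral_tensor mF' mG' ImF ImG).
rewrite (Rintegral_tensor mF mG' ReF ImG) (Rintegral_tensor mF' mG ImF ReG).
by simpc.
Qed.

End ProductIntegral.

Section CircleTorus.
Context {R : realType}.
Local Notation mu := (@lebesgue_measure R).
Local Notation mu2 := (mu \x mu)%E.
Local Notation I01 := (`[0%R, 1%R]%classic : set R).

Lemma measurable_I01 : measurable I01.
Proof. exact: measurable_itv. Qed.

Lemma measure_I01 : mu I01 = 1%E.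
Proof. by rewrite lebesgue_measure_itv/= lte_fin ltr01 oppr0 adde0. Qed.

Lemma measurable_square : measurable (@square R).
Proof. by apply: measurableX; exact: measurable_itv. Qed.

Lemma measure_square : mu2 (@square R) = 1%E.
Proof.
exact: (@measure_setX1 R _ _ _ _ mu mu _ _ measurable_I01 measurable_I01 measure_I01 measure_I01).
Qed.

Definition circle_int (F : R -> R[i]) := cint mu I01 F.
Definition torus_int (F : R * R -> R[i]) := cint mu2 (@square R) F.

Lemma torus_int_prod (F G : R -> R[i]) : bounded_measurable F -> bounded_measurable G ->
  torus_int (fun x => F x.1 * G x.2) = circle_int F * circle_int G.
Proof.
exact: (@cint_tensor R _ _ _ _ mu mu _ _ measurable_I01 measurable_I01 measure_I01 measure_I01).
Qed.

Lemma circle_intD (F G : R -> R[i]) : bounded_measurable F -> bounded_measurable G ->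
  circle_int (fun x => F x + G x) = circle_int F + circle_int G.
Proof.
move=> /(@bm_cintegrable R _ _ mu I01 measurable_I01 measure_I01) iF.
move=> /(@bm_cintegrable R _ _ mu I01 measurable_I01 measure_I01) iG.
exact: (@cintD R _ _ mu I01 measurable_I01).
Qed.

Lemma circle_intZ (c : R[i]) (F : R -> R[i]) : bounded_measurable F ->
  circle_int (fun x => c * F x) = c * circle_int F.
Proof.
move=> /(@bm_cintegrable R _ _ mu I01 measurable_I01 measure_I01) iF.
exact: (@cintZ R _ _ mu I01 measurable_I01).
Qed.

Lemma circle_int_bound (F : R -> R[i]) (b : R) : bounded_measurable F ->
  (forall x, cmod (F x) <= b) -> cmod (circle_int F) <= b *+ 2.
Proof. exact: (@cint_bound R _ _ mu I01 measurable_I01 measure_I01). Qed.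

Lemma circle_int_char k : circle_int (char k) = (k == 0)%:R.
Proof.
have [->|k0] := eqVneq k 0.
  rewrite (_ : char 0 = fun=> 1); last by apply/funext => t; rewrite char0.
  exact: (@cint_cst R _ _ mu I01 measurable_I01 measure_I01).
by rewrite /circle_int /cint integral_Re_char// integral_Im_char.
Qed.

Lemma torus_intZ (c : R[i]) (F : R * R -> R[i]) : bounded_measurable F ->
  torus_int (fun x => c * F x) = c * torus_int F.
Proof.
move=> /(@bm_cintegrable R _ _ mu2 square measurable_square measure_square) iF.
exact: (@cintZ R _ _ mu2 square measurable_square).
Qed.

Lemma torus_int_sum (I : Type) (r : seq I) (P : pred I) (F : I -> R * R -> R[i]) :
  (forall i, bounded_measurable (F i)) ->
  torus_int (fun x => \sum_(i <- r | P i) F i x) = \sum_(i <- r | P i) torus_int (F i).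
Proof. exact: (@cint_sum R _ _ mu2 square measurable_square measure_square). Qed.

End CircleTorus.

(** * The Poisson kernel *)

Section Poisson.
Context {R : realType}.
Implicit Types (z w : R[i]).

(** Iterating gives [f 0 = c ^+ n * f n], where the right-hand side tends to [0]. *)
Lemma bounded_backward_geometric (c : R[i]) (b : R) (f : nat -> R[i]) : cmod c < 1 ->
  (forall n, cmod (f n) <= b) -> (forall n, f n = c * f n.+1) -> f 0 = 0.
Proof.
move=> c1 fb fc.
have f0 n : f 0 = c ^+ n * f n.
  elim: n => [|n IH]; first by rewrite mul1r.
  by rewrite IH {1}fc mulrA -exprSr.
have lim0 : (fun n => cmod c ^+ n * b) @ \oo --> (0 : R).
  rewrite -[X in _ --> X](mul0r b); apply: cvgM; last exact: cvg_cst.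
  by apply: cvg_expr; rewrite ger0_norm ?cmod_ge0.
apply: Normc.eq0_normc; apply/eqP; rewrite eq_le cmod_ge0 andbT.
rewrite -(cvg_lim _ lim0)//; apply: limr_ge; first by apply/cvg_ex; exists 0.
by near=> n; rewrite (f0 n) Normc.normcM cmodX ler_wpM2l ?exprn_ge0 ?cmod_ge0.
Unshelve. all: end_near.
Qed.

(** For [cmod w = 1] the first factor is [cmod (w - z) ^+ 2] expanded as a
trigonometric polynomial in [w].  Multiplying the kernel by it and integrating
against characters yields a linear recurrence for the moments of the kernel. *)
Lemma poisson_identity z w : cmod z < 1 -> cmod w = 1 ->
  (1 + (cmod z ^+ 2)%:C - conjc z * w - z * conjc w) * (poisson_kernel z w)%:C
  = (1 - cmod z ^+ 2)%:C.
Proof.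
move=> z1 w1.
have wz0 : cmod (w - z) != 0.
  rewrite gt_eqF// (lt_le_trans (y := 1 - cmod z)) ?subr_gt0//.
  by rewrite lerBlDr -w1 -{1}(subrK z w) cmodD.
rewrite -mul_conjc.
have -> : 1 + z * conjc z - conjc z * w - z * conjc w = (cmod (w - z) ^+ 2)%:C.
  rewrite -mul_conjc rmorphB/= mulrBl !mulrBr (mul_conjc w) w1 expr1n.
  by rewrite [(1)%:C](_ : _ = 1)//; ring.
by rewrite -rmorphM/= /poisson_kernel mulrC divfK// expf_neq0.
Qed.

Lemma bm_poisson z : cmod z < 1 ->
  bounded_measurable (fun t : R => (poisson_kernel z (circ t))%:C).
Proof.
move=> z1.
have lb t : 1 - cmod z <= cmod (circ t - z).
  by rewrite lerBlDr -(cmod_circ t) -{1}(subrK z (circ t)) cmodD.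
have z1' : 0 < 1 - cmod z by rewrite subr_gt0.
apply: (bm_real (b := (1 - cmod z ^+ 2) / (1 - cmod z) ^+ 2)).
  apply: continuous_measurable_fun => t.
  apply: cvgM; first exact: cvg_cst.
  apply: cvgV; first by rewrite expf_neq0// gt_eqF// (lt_le_trans z1').
  under eq_fun do rewrite sqr_cmod; rewrite sqr_cmod.
  case: z {z1 lb z1'} => a b /=.
  have cc : {for t, continuous (fun x : R => cos (2 * pi * x) - a)}.
    apply: cvgB; last exact: cvg_cst.
    have := @continuous_Re_char R 1 t.
    by rewrite (_ : (fun t => _) = (fun x => cos (2 * pi * x)))//; apply/funext => x; rewrite char1.
  have cs : {for t, continuous (fun x : R => sin (2 * pi * x) - b)}.
    apply: cvgB; last exact: cvg_cst.
    have := @continuous_Im_char R 1 t.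
    by rewrite (_ : (fun t => _) = (fun x => sin (2 * pi * x)))//; apply/funext => x; rewrite char1.
  by apply: cvgD; apply: cvgM.
move=> t; have zz : 0 <= 1 - cmod z ^+ 2.
  by rewrite subr_ge0 exprn_ile1// ?cmod_ge0 ?ltW.
rewrite ger0_norm ?divr_ge0 ?exprn_ge0 ?cmod_ge0// ler_wpM2l//.
rewrite lef_pV2 ?posrE ?exprn_gt0 ?(lt_le_trans z1')//.
by rewrite lerXn2r// ?nnegrE ?cmod_ge0// ltW.
Qed.

Definition poisson_moment z (k : int) : R[i] :=
  circle_int (fun t => (poisson_kernel z (circ t))%:C * char k t).

Lemma bm_poisson_char z k : cmod z < 1 ->
  bounded_measurable (fun t : R => (poisson_kernel z (circ t))%:C * char k t).
Proof. by move=> z1; apply: bmM (bm_poisson z1) (bm_char k). Qed.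

Lemma poisson_moment_rec z k : cmod z < 1 ->
  (1 + (cmod z ^+ 2)%:C) * poisson_moment z k - conjc z * poisson_moment z (k + 1)
   - z * poisson_moment z (k - 1) = (1 - cmod z ^+ 2)%:C * (k == 0)%:R.
Proof.
move=> z1; rewrite /poisson_moment -(mulNr (conjc z)) -(mulNr z) -circle_int_char.
have bP l := bm_poisson_char l z1.
have bc c l : bounded_measurable
  (fun t : R => c * ((poisson_kernel z (circ t))%:C * char l t)).
  exact: bmM (bm_cst c) (bP l).
rewrite -!circle_intZ; do ?exact: bm_char; do ?exact: bP.
rewrite -!circle_intD; do ?[exact: bc|apply: bmD].
congr circle_int; apply/funext => t.
rewrite !charD charN char1 -(poisson_identity z1 (cmod_circ t)); ring.
Qed.

(** The recurrence makes [J (m + 1) - z * J m] a backward geometric sequence of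
ratio [conjc z] for [0 <= m], and [J (- m - 1) - conjc z * J (- m)] one of ratio
[z].  Both are bounded, hence zero, so that [J (m + 1) = z * J m] and
[J (-1) = conjc z * J 0]; the recurrence at [0] then gives [J 0 = 1]. *)
Lemma poisson_momentE z (n : nat) : cmod z < 1 -> poisson_moment z n%:Z = z ^+ n.
Proof.
move=> z1; set J := poisson_moment z.
have [b Jb] : exists b : R, forall k, cmod (J k) <= b.
  have [_ _ [b Pb]] := bm_poisson z1; exists (b *+ 2) => k.
  apply: circle_int_bound; first exact: bm_poisson_char.
  by move=> t; rewrite Normc.normcM cmod_circ mulr1.
have zc1 : cmod (conjc z) < 1 by rewrite cmod_conj.
have bound2 (c : R[i]) k l : cmod c < 1 -> cmod (J k - c * J l) <= b + b.
  move=> c1; apply: le_trans (cmodB _ _) _; apply: lerD => //.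
  rewrite Normc.normcM -[leRHS]mul1r ler_pM ?cmod_ge0//; exact: ltW.
have rec k := poisson_moment_rec k z1.
rewrite -/J in rec.
(* Away from the frequency [0] the right-hand side of the recurrence vanishes. *)
have up (m : nat) : J m.+1%:Z = z * J m%:Z.
  apply/eqP; rewrite -subr_eq0; apply/eqP.
  pose f (i : nat) := J (m + i).+1%:Z - z * J (m + i)%:Z.
  have -> : J m.+1%:Z - z * J m%:Z = f 0%N by rewrite /f addn0.
  apply: (bounded_backward_geometric (c := conjc z) (b := b + b)) => // i.
    exact: bound2.
  have := rec (m + i).+1%:Z.
  rewrite mulr0 /f addnS => /eqP; rewrite -!PoszD.
  rewrite (_ : (m + i).+1%:Z - 1 = (m + i)%:Z); last by rewrite -addn1 PoszD addrK.
  rewrite addn1 -mul_conjc => /eqP E.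
  apply/eqP; rewrite -subr_eq0 -[X in _ == X]E; apply/eqP; ring.
have down : J (-1) = conjc z * J 0.
  apply/eqP; rewrite -subr_eq0; apply/eqP.
  pose f (i : nat) := J (- i.+1%:Z) - conjc z * J (- i%:Z).
  have -> : J (-1) - conjc z * J 0 = f 0%N by rewrite /f oppr0.
  apply: (bounded_backward_geometric (c := z) (b := b + b)) => // i.
    exact: bound2.
  have := rec (- i.+1%:Z).
  rewrite oppr_eq0 mulr0 /f.
  rewrite (_ : - i.+1%:Z + 1 = - i%:Z); last by rewrite -addn1 PoszD opprD subrK.
  rewrite (_ : - i.+1%:Z - 1 = - i.+2%:Z); last by rewrite -[i.+2]addn1 PoszD opprD.
  rewrite -mul_conjc => E.
  apply/eqP; rewrite -subr_eq0 -[X in _ == X]E; apply/eqP; ring.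
have J0 : J 0 = 1.
  have := rec 0; rewrite add0r sub0r down (up 0%N) -mul_conjc mulr1 => E.
  have zz0 : (1 - cmod z ^+ 2)%:C != 0.
    rewrite eq_complex/= eqxx andbT gt_eqF// subr_gt0.
    by rewrite exprn_ilt1// cmod_ge0.
  apply: (mulfI zz0); rewrite mulr1 -[RHS]E rmorphB/= rmorph1 -mul_conjc; ring.
elim: n => [|n IH]; first by rewrite J0.
by rewrite up IH exprS.
Qed.

End Poisson.

(** * Square-integrable functions *)

(** The difference of the two sides is [t * (a - b / t) ^+ 2]. *)
Lemma sqrD_le_weighted {R : realType} (t a b : R) : 0 < t ->
  (a + b) ^+ 2 <= (1 + t) * a ^+ 2 + (1 + t^-1) * b ^+ 2.
Proof.
move=> t0; rewrite -subr_ge0.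
have -> : (1 + t) * a ^+ 2 + (1 + t^-1) * b ^+ 2 - (a + b) ^+ 2 = t * (a - b / t) ^+ 2.
  by field; exact: lt0r_neq0.
by rewrite mulr_ge0 ?sqr_ge0// ltW.
Qed.

Section SquareIntegrable.
Context {R : realType} {d : measure_display} {T : measurableType d}.
Context (mu : {measure set T -> \bar R}) (D : set T).
Hypotheses (mD : measurable D) (muD : mu D = 1%E).
Implicit Types F G : T -> R[i].

Definition square_integrable F : Prop :=
  [/\ measurable_fun D (fun x => complex.Re (F x)),
      measurable_fun D (fun x => complex.Im (F x)) &
      (\int[mu]_(x in D) ((cmod (F x) ^+ 2)%:E) < +oo)%E].

Definition norm2 F : R := Num.sqrt (fine (\int[mu]_(x in D) ((cmod (F x) ^+ 2)%:E))%E).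

Lemma measurable_sqr_cmod F : measurable_fun D (fun x => complex.Re (F x)) ->
  measurable_fun D (fun x => complex.Im (F x)) ->
  measurable_fun D (fun x => cmod (F x) ^+ 2).
Proof.
move=> mR mI; under eq_fun do rewrite sqr_cmod.
by apply: measurable_funD; apply: measurable_funX.
Qed.

Lemma integrable_sqr_cmod F : square_integrable F ->
  mu.-integrable D (EFin \o (fun x => cmod (F x) ^+ 2)).
Proof.
move=> [mR mI foo]; apply/integrableP; split.
  by apply/measurable_EFinP; exact: measurable_sqr_cmod.
under eq_integral do rewrite /= ger0_norm ?sqr_ge0//.
exact: foo.
Qed.

Lemma sqr_norm2 F : norm2 F ^+ 2 = \int[mu]_(x in D) (cmod (F x) ^+ 2).
Proof.
rewrite /norm2 sqr_sqrtr// fine_ge0// integral_ge0// => x _.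
by rewrite lee_fin sqr_ge0.
Qed.

Lemma square_integrable_bound F (h : T -> R) : measurable_fun D (fun x => complex.Re (F x)) ->
  measurable_fun D (fun x => complex.Im (F x)) ->
  mu.-integrable D (EFin \o h) -> (forall x, cmod (F x) ^+ 2 <= h x) ->
  square_integrable F.
Proof.
move=> mR mI ih Fh; split => //.
have /integrableP[_] : mu.-integrable D (EFin \o (fun x => cmod (F x) ^+ 2)).
  apply: (le_integrable mD _ _ ih).
    by apply/measurable_EFinP; exact: measurable_sqr_cmod.
  move=> x _ /=; rewrite lee_fin ger0_norm ?sqr_ge0//.
  by rewrite (le_trans (Fh x)) ?ler_norm.
under eq_integral do rewrite /= ger0_norm ?sqr_ge0//.
by [].
Qed.

Lemma bm_square_integrable F : bounded_measurable F -> square_integrable F.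
Proof.
move=> [mR mI [b Fb]].
apply: (square_integrable_bound (h := fun=> b ^+ 2)); try exact: measurable_funTS.
  apply: (integrable_bounded mD muD (b := b ^+ 2)); first exact: measurable_cst.
  by move=> x; rewrite ger0_norm ?sqr_ge0.
by move=> x; rewrite lerXn2r// ?nnegrE ?cmod_ge0// (le_trans (cmod_ge0 (F x))).
Qed.

Lemma square_integrableB F G : square_integrable F -> square_integrable G ->
  square_integrable (fun x => F x - G x).
Proof.
move=> sF sG; have [mR mI _] := sF; have [mR' mI' _] := sG.
have iF := integrable_scale mD 2 (integrable_sqr_cmod sF).
have iG := integrable_scale mD 2 (integrable_sqr_cmod sG).
apply: (square_integrable_bound (h := fun x => 2 * cmod (F x) ^+ 2 + 2 * cmod (G x) ^+ 2)).
- by under eq_fun do rewrite raddfB/=; exact: measurable_funB.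
- by under eq_fun do rewrite raddfB/=; exact: measurable_funB.
- exact: integrableD iF iG.
- move=> x; apply: (le_trans (y := (cmod (F x) + cmod (G x)) ^+ 2)).
    by rewrite lerXn2r// ?nnegrE ?addr_ge0 ?cmod_ge0 ?cmodB.
  by have := sqrD_le_weighted (cmod (F x)) (cmod (G x)) (@ltr01 R); rewrite invr1.
Qed.

(** The inequality between arithmetic and geometric means for [e] and [x ^+ 2 / e];
it replaces the Cauchy-Schwarz inequality when an integral of [cmod F] has to be
bounded by a bound [e] on the norm of [F]. *)
Lemma le_young (e x : R) : 0 < e -> 0 <= x -> x <= 2^-1 * (e + e^-1 * x ^+ 2).
Proof.
move=> e0 x0; rewrite -subr_ge0.
have -> : 2^-1 * (e + e^-1 * x ^+ 2) - x = 2^-1 * e^-1 * (x - e) ^+ 2.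
  by field; exact: lt0r_neq0.
by rewrite mulr_ge0 ?sqr_ge0// mulr_ge0 ?invr_ge0// ltW.
Qed.

Lemma square_integrable_cintegrable F : square_integrable F -> cintegrable mu D F.
Proof.
move=> sF; have [mR mI _] := sF.
have iy : mu.-integrable D (EFin \o (fun x => 2^-1 * (1 + 1^-1 * cmod (F x) ^+ 2))).
  apply: (integrable_scale mD).
  apply: (integrableD mD (f := EFin \o (fun=> 1)) (g := EFin \o (fun x => 1^-1 * cmod (F x) ^+ 2))).
    by apply: (integrable_bounded mD muD (b := 1)) => [|x]; rewrite ?normr1//; exact: measurable_cst.
  exact/(integrable_scale mD)/integrable_sqr_cmod.
split; apply: (le_integrable mD _ _ iy); try (by apply/measurable_EFinP).
- move=> x _ /=; rewrite lee_fin (le_trans (Re_le_cmod _))//.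
  by rewrite (le_trans (le_young ltr01 (cmod_ge0 _)))// ler_norm.
- move=> x _ /=; rewrite lee_fin (le_trans (Im_le_cmod _))//.
  by rewrite (le_trans (le_young ltr01 (cmod_ge0 _)))// ler_norm.
Qed.

Lemma Rintegral_weighted_bound (k u : T -> R) (b e : R) F : square_integrable F ->
  measurable_fun setT k -> 0 <= b -> (forall x, `|k x| <= b) ->
  mu.-integrable D (EFin \o u) ->
  (forall x, `|u x| <= cmod (F x)) -> norm2 F < e ->
  `|\int[mu]_(x in D) (k x * u x)| <= b * e.
Proof.
move=> sF mk b0 kb iu uF Fe.
have e0 : 0 < e by apply: le_lt_trans Fe; rewrite sqrtr_ge0.
have iku := integrable_bounded_mul mD mk kb iu.
have iS := integrable_scale mD e^-1 (integrable_sqr_cmod sF).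
have ie : mu.-integrable D (EFin \o (fun=> e)).
  by apply: (integrable_bounded mD muD (b := `|e|)) => //; exact: measurable_cst.
have iY : mu.-integrable D (EFin \o (fun x => e + e^-1 * cmod (F x) ^+ 2)).
  exact: integrableD ie iS.
have iY2 := integrable_scale mD 2^-1 iY.
have iY3 := integrable_scale mD b iY2.
apply: le_trans (le_normr_Rintegral mD iku) _.
apply: (le_trans (y := \int[mu]_(x in D) (b * (2^-1 * (e + e^-1 * cmod (F x) ^+ 2))))).
  apply: le_Rintegral => //; first exact: integrable_norm.
  move=> x _; rewrite normrM; apply: ler_pM => //.
  by rewrite (le_trans (uF x))// le_young ?cmod_ge0.
rewrite !RintegralZl// RintegralD// Rintegral_cst// muD mulr1 RintegralZl//; last first.
  exact: integrable_sqr_cmod.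
rewrite -sqr_norm2 ler_wpM2l //.
have : e^-1 * norm2 F ^+ 2 <= e.
  rewrite mulrC ler_pdivrMr// -expr2 lerXn2r// ?nnegrE ?sqrtr_ge0// ltW//.
by move=> h; rewrite mulrC ler_pdivrMr// mulr_natr mulr2n lerD2l.
Qed.

Lemma cint_weighted_bound (k : T -> R) (b e : R) F : square_integrable F ->
  measurable_fun setT k -> 0 <= b -> (forall x, `|k x| <= b) -> norm2 F < e ->
  cmod (cint mu D (fun x => (k x)%:C * F x)) <= b * e *+ 2.
Proof.
move=> sF mk b0 kb Fe; have [iR iI] := square_integrable_cintegrable sF.
apply: le_trans (cmod_le_ReIm _) _; rewrite mulr2n /cint /=.
apply: lerD.
- rewrite (_ : Rintegral _ _ _ = \int[mu]_(x in D) (k x * complex.Re (F x))).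
    by apply: Rintegral_weighted_bound iR _ Fe => // x; exact: Re_le_cmod.
  by apply: eq_Rintegral => x _; case: (F x) => ? ? /=; rewrite mul0r subr0.
- rewrite (_ : Rintegral _ _ _ = \int[mu]_(x in D) (k x * complex.Im (F x))).
    by apply: Rintegral_weighted_bound iI _ Fe => // x; exact: Im_le_cmod.
  by apply: eq_Rintegral => x _; case: (F x) => ? ? /=; rewrite mul0r addr0.
Qed.

(** A form of Minkowski's inequality: [sqrD_le_weighted] is integrated with the
weight [t] that makes its right-hand side a square, and the spare [e] keeps this
weight well defined when [F] has norm zero. *)
Lemma norm2_le_close (e : R) F G : square_integrable F -> square_integrable G ->
  0 < e -> norm2 (fun x => F x - G x) < e -> norm2 G <= norm2 F + e *+ 2.
Proof.
move=> sF sG e0 FGe; have sB := square_integrableB sF sG.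
have NF0 : 0 <= norm2 F by rewrite sqrtr_ge0.
have a0 : 0 < norm2 F + e by rewrite ltr_wpDl.
(* With this weight the weighted sum of [(norm2 F + e) ^+ 2] and [e ^+ 2] is
   exactly [(norm2 F + e + e) ^+ 2]. *)
pose t := e / (norm2 F + e); have t0 : 0 < t by rewrite divr_gt0.
rewrite -(@ler_pXn2r _ 2%N)// ?nnegrE ?sqrtr_ge0 ?addr_ge0 ?mulrn_wge0 ?(ltW e0)//.
have iF := integrable_scale mD (1 + t) (integrable_sqr_cmod sF).
have iB := integrable_scale mD (1 + t^-1) (integrable_sqr_cmod sB).
apply: (le_trans (y := (1 + t) * norm2 F ^+ 2 + (1 + t^-1) * norm2 (fun x => F x - G x) ^+ 2)).
  rewrite !sqr_norm2 -!RintegralZl//; do ?exact: integrable_sqr_cmod.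
  rewrite -RintegralD//; apply: le_Rintegral => //.
  - exact: integrable_sqr_cmod.
  - exact: integrableD iF iB.
  move=> x _; apply: le_trans (sqrD_le_weighted _ _ t0).
  rewrite lerXn2r// ?nnegrE ?addr_ge0 ?cmod_ge0//.
  by rewrite -{1}(subKr (F x) (G x)) cmodB.
have h1 : norm2 F ^+ 2 <= (norm2 F + e) ^+ 2.
  by rewrite lerXn2r// ?nnegrE ?(ltW a0)// lerDl ltW.
have h2 : norm2 (fun x => F x - G x) ^+ 2 <= e ^+ 2.
  by rewrite lerXn2r// ?nnegrE ?sqrtr_ge0// ltW.
apply: (le_trans (y := (1 + t) * (norm2 F + e) ^+ 2 + (1 + t^-1) * e ^+ 2)).
  by apply: lerD; apply: ler_wpM2l => //; rewrite addr_ge0 ?invr_ge0 ?ltW.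
rewrite le_eqVlt; apply/orP; left; apply/eqP.
by rewrite /t; field; rewrite !lt0r_neq0.
Qed.

End SquareIntegrable.

(** * Polynomials on the torus and their Poisson extensions *)

Section TorusFunctions.
Context {R : realType}.
Local Notation C := R[i].
Local Notation mu := (@lebesgue_measure R).
Local Notation mu2 := (mu \x mu)%E.
Implicit Types (f g : C -> C -> C) (z : C).

Lemma L2normE f : L2norm f = norm2 mu2 square (angular f).
Proof. by []. Qed.

Lemma L2norm_ge0 f : 0 <= L2norm f.
Proof. exact: sqrtr_ge0. Qed.

Definition bipoisson z1 z2 (x : R * R) : R :=
  poisson_kernel z1 (circ x.1) * poisson_kernel z2 (circ x.2).

Lemma extensionE f z1 z2 :
  extension f z1 z2 = torus_int (fun x => (bipoisson z1 z2 x)%:C * angular f x).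
Proof.
rewrite /extension /torus_int /cint; congr (_ +i* _); apply: eq_Rintegral => x _.
  by case: (angular f x) => a b /=; rewrite mul0r subr0.
by case: (angular f x) => a b /=; rewrite mul0r addr0.
Qed.

Lemma bm_fst (F : R -> C) : bounded_measurable F ->
  bounded_measurable (fun x : R * R => F x.1).
Proof. by apply: bm_comp; exact: measurable_fst. Qed.

Lemma bm_snd (F : R -> C) : bounded_measurable F ->
  bounded_measurable (fun x : R * R => F x.2).
Proof. by apply: bm_comp; exact: measurable_snd. Qed.

Lemma bm_bipoisson z1 z2 : in_bidisc z1 z2 ->
  bounded_measurable (fun x => (bipoisson z1 z2 x)%:C).
Proof.
move=> [z1lt z2lt]; rewrite /bipoisson; under eq_fun do rewrite rmorphM/=.
exact: bmM (bm_fst (bm_poisson z1lt)) (bm_snd (bm_poisson z2lt)).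
Qed.

(** The sum is indexed by pairs so that Parseval's identity is a single double sum. *)
Definition tpoly N (c : nat -> nat -> C) z1 z2 : C :=
  \sum_(u : 'I_N * 'I_N) c u.1 u.2 * (z1 ^+ u.1 * z2 ^+ u.2).

Definition coef_norm2 N (c : nat -> nat -> C) : R :=
  \sum_(u : 'I_N * 'I_N) cmod (c u.1 u.2) ^+ 2.

Lemma angular_tpoly N c (x : R * R) : angular (tpoly N c) x =
  \sum_(u : 'I_N * 'I_N) c u.1 u.2 * (char (u.1 : nat)%:Z x.1 * char (u.2 : nat)%:Z x.2).
Proof. by rewrite /angular /tpoly; apply: eq_bigr => u _; rewrite !circX. Qed.

Lemma bm_char2 (k l : int) : bounded_measurable (fun x : R * R => char k x.1 * char l x.2).
Proof. exact: bmM (bm_fst (bm_char k)) (bm_snd (bm_char l)). Qed.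

Lemma bm_angular_tpoly N c : bounded_measurable (angular (tpoly N c)).
Proof.
rewrite (_ : angular _ = fun x => \sum_(u : 'I_N * 'I_N)
  c u.1 u.2 * (char (u.1 : nat)%:Z x.1 * char (u.2 : nat)%:Z x.2)); last first.
  by apply/funext => x; rewrite angular_tpoly.
by apply: bm_sum => u; apply: bmM (bm_cst _) (bm_char2 _ _).
Qed.

Lemma in_L2_tpoly N c : in_L2 (tpoly N c).
Proof.
exact: (@bm_square_integrable R _ _ mu2 square measurable_square measure_square _
  (bm_angular_tpoly N c)).
Qed.

Lemma extension_tpoly N c z1 z2 : in_bidisc z1 z2 ->
  extension (tpoly N c) z1 z2 = tpoly N c z1 z2.
Proof.
move=> zz; have [z1lt z2lt] := zz; rewrite extensionE.
pose P1 (u : 'I_N * 'I_N) t : C := (poisson_kernel z1 (circ t))%:C * char (u.1 : nat)%:Z t.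
pose P2 (u : 'I_N * 'I_N) t : C := (poisson_kernel z2 (circ t))%:C * char (u.2 : nat)%:Z t.
have bP1 u : bounded_measurable (P1 u) by exact: bm_poisson_char.
have bP2 u : bounded_measurable (P2 u) by exact: bm_poisson_char.
have bP u : bounded_measurable (fun x : R * R => P1 u x.1 * P2 u x.2).
  exact: bmM (bm_fst (bP1 u)) (bm_snd (bP2 u)).
rewrite (_ : (fun x => _) = (fun x => \sum_(u : 'I_N * 'I_N)
    c u.1 u.2 * (P1 u x.1 * P2 u x.2))); last first.
  apply/funext => x; rewrite angular_tpoly mulr_sumr; apply: eq_bigr => u _.
  by rewrite /P1 /P2 /bipoisson rmorphM/=; ring.
rewrite torus_int_sum; last by move=> u; apply: bmM (bm_cst _) (bP u).
apply: eq_bigr => u _; rewrite torus_intZ// torus_int_prod//.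
by rewrite -[circle_int (P1 u)]/(poisson_moment z1 u.1)
  -[circle_int (P2 u)]/(poisson_moment z2 u.2) !poisson_momentE.
Qed.

Lemma torus_int_char2 (k l : int) :
  torus_int (fun x : R * R => char k x.1 * char l x.2) = ((k == 0) && (l == 0))%:R.
Proof.
rewrite torus_int_prod; [|exact: bm_char..].
by rewrite !circle_int_char -natrM mulnb.
Qed.

(** Parseval's identity. *)
Lemma L2norm_tpoly N c : L2norm (tpoly N c) ^+ 2 = coef_norm2 N c.
Proof.
rewrite L2normE sqr_norm2.
pose I : finType := ('I_N * 'I_N)%type.
pose F := angular (tpoly N c).
pose D (u v : I) (x : R * R) : C :=
  char ((u.1 : nat)%:Z - (v.1 : nat)%:Z) x.1 * char ((u.2 : nat)%:Z - (v.2 : nat)%:Z) x.2.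
have bD u v : bounded_measurable (D u v) by exact: bm_char2.
have FFE x : (cmod (F x) ^+ 2)%:C =
    \sum_(u : I) \sum_(v : I) (c u.1 u.2 * conjc (c v.1 v.2)) * D u v x.
  rewrite -mul_conjc {1}/F angular_tpoly mulr_suml; apply: eq_bigr => u _.
  rewrite /F angular_tpoly (rmorph_sum conjc)/= mulr_sumr; apply: eq_bigr => v _.
  rewrite !(rmorphM conjc) /D !charD !charN/=; ring.
have -> : \int[mu2]_(x in square) (cmod (F x) ^+ 2)
    = complex.Re (torus_int (fun x => (cmod (F x) ^+ 2)%:C)) by [].
under [X in torus_int X]eq_fun do rewrite FFE.
rewrite torus_int_sum; last first.
  by move=> u; apply: bm_sum => v; apply: bmM (bm_cst _) (bD u v).
rewrite raddf_sum; apply: eq_bigr => u _.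
rewrite torus_int_sum; last by move=> v; apply: bmM (bm_cst _) (bD u v).
rewrite (bigD1 u)//= big1 ?addr0 => [|v vu].
  by rewrite torus_intZ// /D torus_int_char2 !subrr eqxx/= mulr1 mul_conjc.
rewrite torus_intZ// /D torus_int_char2 !subr_eq0 !eqz_nat.
rewrite (_ : _ && _ = false) ?mulr0//; apply/negbTE; apply: contra vu.
by rewrite -pair_eqE/= eq_sym [X in _ && X]eq_sym.
Qed.

(** The bound [N] on the degree can be enlarged freely, so two polynomials can be
given the same one, at least [3]. *)
Lemma poly2_tpoly (p : {poly {poly C}}) :
  exists N0, forall N, (N0 <= N)%N -> poly2 p = tpoly N (fun i j => (p`_j)`_i).
Proof.
exists (maxn (size p) (\max_(j < size p) size (p`_j)%R)) => N.
rewrite geq_max => /andP[pN cN]; apply/funext => z1; apply/funext => z2.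
rewrite /poly2 /tpoly (horner_coef_wide _ pN) horner_sum.
rewrite -(pair_bigA _ (fun i j : 'I_N => (p`_j)`_i * (z1 ^+ i * z2 ^+ j)))/= exchange_big/=.
apply: eq_bigr => j _; rewrite hornerM horner_exp hornerC.
have jN : (size (p`_j)%R <= N)%N.
  have [jp|jp] := ltnP j (size p); last by rewrite nth_default ?size_poly0.
  apply: leq_trans cN; exact: (leq_bigmax (Ordinal jp)).
rewrite (horner_coef_wide _ jN) mulr_suml; apply: eq_bigr => i _; by rewrite mulrA.
Qed.

Lemma tpoly_poly2 N c : exists p, tpoly N c = poly2 p.
Proof.
exists (\sum_(u : 'I_N * 'I_N) (c u.1 u.2 *: 'X^(u.1))%:P * 'X^(u.2)).
apply/funext => z1; apply/funext => z2.
rewrite /poly2 !horner_sum; apply: eq_bigr => u _.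
by rewrite !hornerE.
Qed.

(** A polynomial is its own approximation. *)
Lemma in_H2_tpoly N c : in_H2 (tpoly N c).
Proof.
split=> [|e e0]; first exact: in_L2_tpoly.
have [p ->] := tpoly_poly2 N c; exists p.
rewrite (_ : (fun _ _ => _) = tpoly 0 c); last first.
  by apply/funext => z1; apply/funext => z2; rewrite subrr /tpoly big_pred0// => -[[]].
rewrite (_ : L2norm _ = 0)//; apply/eqP; rewrite -sqrf_eq0 L2norm_tpoly.
by rewrite /coef_norm2 big_pred0// => -[[]].
Qed.

(** The kernel is bounded at a fixed point of the bidisc, and on a space of measure
[1] the integral of the modulus is at most the [L^2] norm. *)
Lemma extension_close g z1 z2 : in_L2 g -> in_bidisc z1 z2 ->
  exists K : R, forall N c (e : R), L2norm (fun w1 w2 => g w1 w2 - tpoly N c w1 w2) < e ->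
    cmod (extension g z1 z2 - tpoly N c z1 z2) <= K * e.
Proof.
move=> Lg zz; have [mk _ [b kb]] := bm_bipoisson zz.
have b0 : 0 <= b by apply: le_trans (kb (0, 0)); exact: cmod_ge0.
exists (b *+ 2) => N c e ge; rewrite mulrnAl -extension_tpoly// !extensionE.
have Lp := in_L2_tpoly N c.
have LB := @square_integrableB R _ _ mu2 square measurable_square _ _ Lg Lp.
have kb' x : `|bipoisson z1 z2 x| <= b by rewrite -cmod_real.
suff -> : torus_int (fun x => (bipoisson z1 z2 x)%:C * angular g x)
  - torus_int (fun x => (bipoisson z1 z2 x)%:C * angular (tpoly N c) x)
  = cint mu2 square (fun x => (bipoisson z1 z2 x)%:C *
       (angular g x - angular (tpoly N c) x)).
  exact: (@cint_weighted_bound R _ _ mu2 square measurable_square measure_square _ _ _ _ LB mk b0 kb' ge).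
have iw f : in_L2 f -> cintegrable mu2 square (fun x => (bipoisson z1 z2 x)%:C * angular f x).
  move=> Lf.
  have [iR iI] := @square_integrable_cintegrable R _ _ mu2 square measurable_square measure_square _ Lf.
  split.
  - rewrite (_ : (fun x => _) = (fun x => bipoisson z1 z2 x * complex.Re (angular f x))).
      exact: (@integrable_bounded_mul R _ _ mu2 square measurable_square _ _ b mk kb' iR).
    by apply/funext => x; case: (angular f x) => ? ? /=; rewrite mul0r subr0.
  - rewrite (_ : (fun x => _) = (fun x => bipoisson z1 z2 x * complex.Im (angular f x))).
      exact: (@integrable_bounded_mul R _ _ mu2 square measurable_square _ _ b mk kb' iI).
    by apply/funext => x; case: (angular f x) => ? ? /=; rewrite mul0r addr0.
have iB := iw (fun w1 w2 => g w1 w2 - tpoly N c w1 w2) LB.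
have E := @cintD R _ _ mu2 square measurable_square _ _ iB (iw _ Lp).
apply/eqP; rewrite subr_eq; apply/eqP; apply: etrans E.
by congr cint; apply/funext => x; rewrite -mulrDr subrK.
Qed.

Lemma L2norm_close g N c (e : R) : in_L2 g -> 0 < e ->
  L2norm (fun w1 w2 => g w1 w2 - tpoly N c w1 w2) < e ->
  L2norm (tpoly N c) <= L2norm g + e *+ 2.
Proof.
move=> Lg; exact: (@norm2_le_close R _ _ mu2 square measurable_square _ _ _ Lg (in_L2_tpoly N c)).
Qed.

End TorusFunctions.

(** * The Hankel form and its finite-difference version *)

Section RealInequalities.
Context {R : realType}.
Implicit Types a b x y : R.

Lemma cauchy_schwarz3 a1 a2 a3 b1 b2 b3 :
  a1 * b1 + a2 * b2 + a3 * b3 <=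
  Num.sqrt (a1 ^+ 2 + a2 ^+ 2 + a3 ^+ 2) * Num.sqrt (b1 ^+ 2 + b2 ^+ 2 + b3 ^+ 2).
Proof.
rewrite -sqrtrM ?addr_ge0 ?sqr_ge0//.
apply: le_trans (ler_norm _) _; rewrite -sqrtr_sqr ler_wsqrtr// -subr_ge0.
have -> : (a1 ^+ 2 + a2 ^+ 2 + a3 ^+ 2) * (b1 ^+ 2 + b2 ^+ 2 + b3 ^+ 2)
    - (a1 * b1 + a2 * b2 + a3 * b3) ^+ 2
  = (a1 * b2 - a2 * b1) ^+ 2 + (a1 * b3 - a3 * b1) ^+ 2 + (a2 * b3 - a3 * b2) ^+ 2.
  by ring.
by rewrite !addr_ge0 ?sqr_ge0.
Qed.

(** The norm bound for the Hankel form, for coefficients replaced by their moduli.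
The vector [(A, B, A)] has norm at most [1] and the matrix with rows [(A, B)]
and [(B, A)] has norm [A + B <= 1]; a last use of the Cauchy-Schwarz inequality
adds up the constant term paired with degree two, degree two paired with the
constant term, and degree one paired with itself. *)
Lemma hankel_bound_real A B x00 x10 x01 x20 x11 x02 y00 y10 y01 y20 y11 y02 :
  0 <= A -> 0 <= B -> A + B <= 1 -> A ^+ 2 + B ^+ 2 + A ^+ 2 <= 1 ->
  0 <= x00 -> 0 <= y00 ->
  A * (x00 * y20 + x10 * y10 + x20 * y00 + x00 * y02 + x01 * y01 + x02 * y00)
  + B * (x00 * y11 + x10 * y01 + x01 * y10 + x11 * y00) <=
  Num.sqrt (x00 ^+ 2 + x10 ^+ 2 + x01 ^+ 2 + x20 ^+ 2 + x11 ^+ 2 + x02 ^+ 2) *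
  Num.sqrt (y00 ^+ 2 + y10 ^+ 2 + y01 ^+ 2 + y20 ^+ 2 + y11 ^+ 2 + y02 ^+ 2).
Proof.
move=> A0 B0 AB AAB x0 y0.
pose s a1 a2 a3 : R := Num.sqrt (a1 ^+ 2 + a2 ^+ 2 + a3 ^+ 2).
have s0 a1 a2 a3 : 0 <= s a1 a2 a3 by exact: sqrtr_ge0.
have ss a1 a2 a3 : s a1 a2 a3 ^+ 2 = a1 ^+ 2 + a2 ^+ 2 + a3 ^+ 2.
  by rewrite sqr_sqrtr ?addr_ge0 ?sqr_ge0.
have top a1 a2 a3 : A * a1 + B * a2 + A * a3 <= s a1 a2 a3.
  apply: le_trans (cauchy_schwarz3 _ _ _ _ _ _) _.
  rewrite -[leRHS]mul1r ler_wpM2r// -[leRHS]sqrtr1 ler_wsqrtr//.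
have h1 := cauchy_schwarz3 x10 x01 0 y10 y01 0.
have h2 := cauchy_schwarz3 x10 x01 0 y01 y10 0.
rewrite !mulr0 !addr0 -/(s _ _ _) in h1 h2.
rewrite -/(s x10 x01 0) -/(s y10 y01 0) in h1.
rewrite -/(s x10 x01 0) (_ : y01 ^+ 2 + y10 ^+ 2 + 0 ^+ 2 = y10 ^+ 2 + y01 ^+ 2 + 0 ^+ 2) in h2; last by ring.
rewrite -/(s y10 y01 0) in h2.
apply: (le_trans (y := x00 * s y20 y11 y02 + s x20 x11 x02 * y00 + s x10 x01 0 * s y10 y01 0)).
  have := ler_wpM2l x0 (top y20 y11 y02); have := ler_wpM2l y0 (top x20 x11 x02).
  have := ler_wpM2l A0 h1; have := ler_wpM2l B0 h2.
  have : (A + B) * (s x10 x01 0 * s y10 y01 0) <= 1 * (s x10 x01 0 * s y10 y01 0).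
    by rewrite ler_wpM2r// mulr_ge0.
  by lra.
apply: le_trans (cauchy_schwarz3 _ _ _ _ _ _) _.
by rewrite !ss ler_pM ?sqrtr_ge0// ler_wsqrtr//; lra.
Qed.

Lemma sum_half_le2 n : \sum_(i < n) (2^-1 : R) ^+ i <= 2.
Proof.
have -> : \sum_(i < n) (2^-1 : R) ^+ i = 2 - 2 * 2^-1 ^+ n.
  elim: n => [|n IH]; first by rewrite big_ord0 expr0; ring.
  by rewrite big_ord_recr/= IH exprS; field.
by rewrite gerBl mulr_ge0// exprn_ge0// invr_ge0.
Qed.

End RealInequalities.

Section FiniteDifference.
Context {R : realType}.
Local Notation C := R[i].
Implicit Types (c d : nat -> nat -> C) (F G : C -> C -> C) (A B r M : R).

(** Second difference quotients with step [r]: pure ones along the two axes, weighted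
by [A], approximate [f_20 + f_02], and the mixed one, weighted by [B],
approximates [f_11]. *)
Definition secdiff A B r F : C :=
  (A / (2 * r ^+ 2))%:C * (F r%:C 0 + F (- r%:C) 0 + F 0 r%:C + F 0 (- r%:C) - 4 * F 0 0)
  + (B / (4 * r ^+ 2))%:C *
    (F r%:C r%:C - F r%:C (- r%:C) - F (- r%:C) r%:C + F (- r%:C) (- r%:C)).

Lemma secdiffB A B r F G :
  secdiff A B r F - secdiff A B r G = secdiff A B r (fun z1 z2 => F z1 z2 - G z1 z2).
Proof. by rewrite /secdiff; ring. Qed.

Lemma secdiff_sum A B r (I : Type) (s : seq I) (F : I -> C -> C -> C) :
  secdiff A B r (fun z1 z2 => \sum_(i <- s) F i z1 z2) = \sum_(i <- s) secdiff A B r (F i).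
Proof.
elim: s => [|i s IH]; first by rewrite /secdiff !big_nil; ring.
by rewrite big_cons -IH /secdiff !big_cons; ring.
Qed.

Definition stencil r : seq C := [:: 0; r%:C; - r%:C].

Lemma secdiff_bound A B r F M : 0 <= A -> 0 <= B -> A + B <= 1 -> 0 < r ->
  {in stencil r &, forall z1 z2, cmod (F z1 z2) <= M} ->
  cmod (secdiff A B r F) <= 5 * M / r ^+ 2.
Proof.
move=> A0 B0 AB r0 FM.
have m0 : 0 \in stencil r by rewrite !inE eqxx.
have mr : r%:C \in stencil r by rewrite !inE eqxx orbT.
have mN : - r%:C \in stencil r by rewrite !inE eqxx !orbT.
have r2 : 0 < r ^+ 2 by rewrite exprn_gt0.
have cR (x : R) z : 0 <= x -> cmod (x%:C * z) = x * cmod z.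
  by move=> x0; rewrite Normc.normcM cmod_real ger0_norm.
have M0 : 0 <= M by apply: le_trans (FM 0 0 m0 m0); exact: cmod_ge0.
have c4 : (4 : C) = (4 : R)%:C by rewrite rmorph_nat.
apply: le_trans (cmodD _ _) _.
rewrite !cR; [|by rewrite divr_ge0// mulr_ge0// ltW..].
have h1 : cmod (F r%:C 0 + F (- r%:C) 0 + F 0 r%:C + F 0 (- r%:C) - 4 * F 0 0) <= 8 * M.
  have := FM _ _ mr m0; have := FM _ _ mN m0; have := FM _ _ m0 mr; have := FM _ _ m0 mN.
  have := FM _ _ m0 m0.
  have := cmodB (F r%:C 0 + F (- r%:C) 0 + F 0 r%:C + F 0 (- r%:C)) (4 * F 0 0).
  have := cmodD (F r%:C 0 + F (- r%:C) 0 + F 0 r%:C) (F 0 (- r%:C)).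
  have := cmodD (F r%:C 0 + F (- r%:C) 0) (F 0 r%:C).
  have := cmodD (F r%:C 0) (F (- r%:C) 0).
  by rewrite c4 cR//; lra.
have h2 : cmod (F r%:C r%:C - F r%:C (- r%:C) - F (- r%:C) r%:C + F (- r%:C) (- r%:C)) <= 4 * M.
  have := FM _ _ mr mr; have := FM _ _ mN mr; have := FM _ _ mr mN; have := FM _ _ mN mN.
  have := cmodD (F r%:C r%:C - F r%:C (- r%:C) - F (- r%:C) r%:C) (F (- r%:C) (- r%:C)).
  have := cmodB (F r%:C r%:C - F r%:C (- r%:C)) (F (- r%:C) r%:C).
  have := cmodB (F r%:C r%:C) (F r%:C (- r%:C)).
  by lra.
have k1 : 0 <= A / (2 * r ^+ 2) by rewrite divr_ge0// mulr_ge0// ltW.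
have k2 : 0 <= B / (4 * r ^+ 2) by rewrite divr_ge0// mulr_ge0// ltW.
apply: le_trans (lerD (ler_wpM2l k1 h1) (ler_wpM2l k2 h2)) _.
have -> : A / (2 * r ^+ 2) * (8 * M) + B / (4 * r ^+ 2) * (4 * M) = (4 * A + B) * M / r ^+ 2.
  by field; rewrite lt0r_neq0.
by rewrite ler_wpM2r ?invr_ge0 ?(ltW r2)// ler_wpM2r//; lra.
Qed.

Definition quad c (z1 z2 : C) : C :=
  c 0%N 0%N + c 1%N 0%N * z1 + c 0%N 1%N * z2
  + c 2%N 0%N * z1 ^+ 2 + c 1%N 1%N * (z1 * z2) + c 0%N 2%N * z2 ^+ 2.

(** The form [(g, h) |-> A ((g h)_20 + (g h)_02) + B (g h)_11] in terms of Taylor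
coefficients. *)
Definition hankel A B c d : C :=
  A%:C * (c 0%N 0%N * d 2%N 0%N + c 1%N 0%N * d 1%N 0%N + c 2%N 0%N * d 0%N 0%N
          + c 0%N 0%N * d 0%N 2%N + c 0%N 1%N * d 0%N 1%N + c 0%N 2%N * d 0%N 0%N)
  + B%:C * (c 0%N 0%N * d 1%N 1%N + c 1%N 0%N * d 0%N 1%N + c 0%N 1%N * d 1%N 0%N
            + c 1%N 1%N * d 0%N 0%N).

(** The error of the second differences on a product of two quadratic polynomials:
differences of odd monomials vanish, and only the coefficients of [z1 ^ 4],
[z2 ^ 4], [z1 ^ 3 z2] and [z1 z2 ^ 3] remain. *)
Definition quartic A B c d : C :=
  A%:C * (c 2%N 0%N * d 2%N 0%N + c 0%N 2%N * d 0%N 2%N)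
  + B%:C * (c 2%N 0%N * d 1%N 1%N + c 1%N 1%N * d 2%N 0%N
            + c 1%N 1%N * d 0%N 2%N + c 0%N 2%N * d 1%N 1%N).

Lemma secdiff_quad A B r c d : r != 0 ->
  secdiff A B r (fun z1 z2 => quad c z1 z2 * quad d z1 z2)
  = hankel A B c d + (r ^+ 2)%:C * quartic A B c d.
Proof.
move=> r0; have rC : r%:C != 0 by rewrite eq_complex/= eqxx andbT.
rewrite /secdiff /quad /hankel /quartic !rmorphM/= !fmorphV/= !rmorphM/= !rmorph_nat.
by field.
Qed.

End FiniteDifference.

(** * The finite-difference bound for polynomials *)

Section PolynomialEstimate.
Context {R : realType}.
Local Notation C := R[i].
Implicit Types (c d : nat -> nat -> C) (A B r : R).

Lemma tpoly3E c (z1 z2 : C) : tpoly 3 c z1 z2 = quad c z1 z2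
  + (c 2%N 1%N * (z1 ^+ 2 * z2) + c 1%N 2%N * (z1 * z2 ^+ 2) + c 2%N 2%N * (z1 ^+ 2 * z2 ^+ 2)).
Proof.
rewrite /tpoly -(pair_bigA _ (fun i j : 'I_3 => c i j * (z1 ^+ i * z2 ^+ j)))/=.
by rewrite !big_ord_recl !big_ord0 /= /bump /= /quad; ring.
Qed.

Lemma coef_norm2_3E c : coef_norm2 3 c =
  cmod (c 0%N 0%N) ^+ 2 + cmod (c 1%N 0%N) ^+ 2 + cmod (c 0%N 1%N) ^+ 2
  + cmod (c 2%N 0%N) ^+ 2 + cmod (c 1%N 1%N) ^+ 2 + cmod (c 0%N 2%N) ^+ 2
  + (cmod (c 2%N 1%N) ^+ 2 + cmod (c 1%N 2%N) ^+ 2 + cmod (c 2%N 2%N) ^+ 2).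
Proof.
rewrite /coef_norm2 -(pair_bigA _ (fun i j : 'I_3 => cmod (c i j) ^+ 2))/=.
by rewrite !big_ord_recl !big_ord0 /= /bump /=; ring.
Qed.

Lemma big_ord_support (V : nmodType) (F : nat -> V) m n : (m <= n)%N ->
  (forall i, (m <= i)%N -> F i = 0) -> \sum_(i < n) F i = \sum_(i < m) F i.
Proof.
move=> mn F0; rewrite (big_ord_widen _ F mn) [RHS]big_mkcond/=.
by apply: eq_bigr => i _; case: ltnP => // /F0.
Qed.

Definition low_coef c i j : C := if (i + j < 3)%N then c i j else 0.
Definition high_coef c i j : C := if (i + j < 3)%N then 0 else c i j.

Lemma tpoly_split N c (z1 z2 : C) : (3 <= N)%N ->
  tpoly N c z1 z2 = quad c z1 z2 + tpoly N (high_coef c) z1 z2.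
Proof.
move=> N3; have -> : quad c z1 z2 = tpoly N (low_coef c) z1 z2.
  rewrite [RHS](_ : _ = tpoly 3 (low_coef c) z1 z2).
    by rewrite tpoly3E /quad /low_coef /=; ring.
  rewrite /tpoly -(pair_bigA _ (fun i j : 'I_N => low_coef c i j * (z1 ^+ i * z2 ^+ j)))/=.
  rewrite -(pair_bigA _ (fun i j : 'I_3 => low_coef c i j * (z1 ^+ i * z2 ^+ j)))/=.
  pose T m i := \sum_(j < m) low_coef c i j * (z1 ^+ i * z2 ^+ j).
  transitivity (\sum_(i < N) T 3%N i).
    apply: eq_bigr => i _.
    apply: (big_ord_support (F := fun j => low_coef c i j * (z1 ^+ i * z2 ^+ j)) N3) => j j3.
    by rewrite /low_coef ltnNge (leq_trans j3) ?leq_addl// mul0r.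
  apply: (big_ord_support (F := T 3%N) N3) => i i3; rewrite /T big1// => j _.
  by rewrite /low_coef ltnNge (leq_trans i3) ?leq_addr// mul0r.
rewrite /tpoly -big_split; apply: eq_bigr => u _ /=; rewrite -mulrDl; congr (_ * _).
by rewrite /low_coef /high_coef; case: ifP; rewrite ?addr0 ?add0r.
Qed.

Lemma cmod_coef_le N c (u : 'I_N * 'I_N) :
  cmod (c u.1 u.2) <= Num.sqrt (coef_norm2 N c).
Proof.
rewrite -(ger0_norm (cmod_ge0 _)) -sqrtr_sqr ler_wsqrtr// /coef_norm2.
by rewrite (bigD1 u)//= lerDl sumr_ge0// => v _; exact: sqr_ge0.
Qed.

Lemma low_coef_norm2_le N c : (3 <= N)%N ->
  cmod (c 0%N 0%N) ^+ 2 + cmod (c 1%N 0%N) ^+ 2 + cmod (c 0%N 1%N) ^+ 2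
  + cmod (c 2%N 0%N) ^+ 2 + cmod (c 1%N 1%N) ^+ 2 + cmod (c 0%N 2%N) ^+ 2 <= coef_norm2 N c.
Proof.
move=> N3; apply: (le_trans (y := coef_norm2 3 c)).
  by rewrite coef_norm2_3E lerDl !addr_ge0 ?sqr_ge0.
rewrite /coef_norm2 -(pair_bigA _ (fun i j : 'I_3 => cmod (c i j) ^+ 2))/=.
rewrite -(pair_bigA _ (fun i j : 'I_N => cmod (c i j) ^+ 2))/=.
pose T m i := \sum_(j < m) cmod (c i j) ^+ 2.
have T0 m i : 0 <= T m i by apply: sumr_ge0 => j _; exact: sqr_ge0.
have widen (F : nat -> R) : (forall i, 0 <= F i) -> \sum_(i < 3) F i <= \sum_(i < N) F i.
  move=> F0; rewrite (big_ord_widen _ F N3) big_mkcond/=.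
  by apply: ler_sum => i _; case: ifP.
apply: (le_trans (y := \sum_(i < 3) T N i)).
  by apply: ler_sum => i _; apply: (widen (fun j => cmod (c i j) ^+ 2)) => j; exact: sqr_ge0.
exact: (widen (T N)).
Qed.

Lemma quad_bound c (P : R) (z1 z2 : C) : cmod z1 <= 1 -> cmod z2 <= 1 ->
  (forall i j, (i + j < 3)%N -> cmod (c i j) <= P) -> cmod (quad c z1 z2) <= 6 * P.
Proof.
move=> h1 h2 cP; have P0 : 0 <= P by apply: le_trans (cP 0%N 0%N isT); exact: cmod_ge0.
have term i j w : (i + j < 3)%N -> cmod w <= 1 -> cmod (c i j * w) <= P.
  move=> ij w1; rewrite Normc.normcM -[leRHS]mulr1.
  by rewrite ler_pM ?cmod_ge0 ?cP.
have z11 : cmod (z1 ^+ 2) <= 1 by rewrite cmodX exprn_ile1 ?cmod_ge0.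
have z22 : cmod (z2 ^+ 2) <= 1 by rewrite cmodX exprn_ile1 ?cmod_ge0.
have z12 : cmod (z1 * z2) <= 1 by rewrite Normc.normcM mulr_ile1 ?cmod_ge0.
have -> : 6 * P = P + P + P + P + P + P by ring.
rewrite /quad; do 5?(apply: le_trans (cmodD _ _) _; apply: lerD); try exact: term.
exact: cP.
Qed.

(** A term of total degree [k >= 3] is at most [P * r ^+ k], that is at most
[8 * P * r ^+ 3 * 2^-1 ^+ k]; the sum of the double geometric series is at most
[4]. *)
Lemma tail_bound N c (P r : R) (z1 z2 : C) : r <= 2^-1 -> cmod z1 <= r -> cmod z2 <= r ->
  (forall u : 'I_N * 'I_N, cmod (c u.1 u.2) <= P) -> 0 <= P ->
  cmod (tpoly N (high_coef c) z1 z2) <= 32 * P * r ^+ 3.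
Proof.
move=> r2 h1 h2 cP P0; have r0 : 0 <= r by apply: le_trans h1; exact: cmod_ge0.
apply: le_trans (cmod_sum _ _ _) _.
apply: (le_trans (y := \sum_(u : 'I_N * 'I_N) (8 * P * r ^+ 3) * (2^-1 ^+ u.1 * 2^-1 ^+ u.2))).
  apply: ler_sum => u _; rewrite /high_coef; case: ltnP => u3.
    by rewrite mul0r Normc.normc0 !mulr_ge0 ?exprn_ge0 ?invr_ge0.
  rewrite !Normc.normcM !cmodX.
  apply: (le_trans (y := P * (r ^+ u.1 * r ^+ u.2))).
    apply: ler_pM; rewrite ?mulr_ge0 ?exprn_ge0 ?cmod_ge0//.
    by apply: ler_pM; rewrite ?exprn_ge0 ?cmod_ge0// lerXn2r// ?nnegrE ?cmod_ge0.
  have -> : 8 * P * r ^+ 3 * (2^-1 ^+ u.1 * 2^-1 ^+ u.2)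
      = P * (r ^+ 3 * (8 * 2^-1 ^+ (u.1 + u.2))) by rewrite exprD; ring.
  rewrite ler_wpM2l// -exprD -(subnKC u3) !exprD ler_wpM2l ?exprn_ge0//.
  have -> : (8 : R) * (2^-1 ^+ 3 * 2^-1 ^+ (u.1 + u.2 - 3)) = 2^-1 ^+ (u.1 + u.2 - 3).
    by field.
  by rewrite lerXn2r// ?nnegrE ?invr_ge0.
rewrite -mulr_sumr -(pair_bigA _ (fun i j : 'I_N => (2^-1 : R) ^+ i * 2^-1 ^+ j))/=.
under eq_bigr do rewrite -mulr_sumr.
rewrite -mulr_suml; set S := \sum_(i < N) _.
have S0 : 0 <= S by apply: sumr_ge0 => i _; rewrite exprn_ge0// invr_ge0.
have -> : 32 * P * r ^+ 3 = 8 * P * r ^+ 3 * (2 * 2) by ring.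
rewrite ler_wpM2l ?mulr_ge0 ?exprn_ge0//.
by apply: ler_pM => //; exact: sum_half_le2.
Qed.

Lemma hankel_bound A B N c d : (3 <= N)%N -> 0 <= A -> 0 <= B -> A + B <= 1 ->
  A ^+ 2 + B ^+ 2 + A ^+ 2 <= 1 ->
  cmod (hankel A B c d) <= Num.sqrt (coef_norm2 N c) * Num.sqrt (coef_norm2 N d).
Proof.
move=> N3 A0 B0 AB AAB.
apply: (le_trans (y := A * (cmod (c 0%N 0%N) * cmod (d 2%N 0%N) + cmod (c 1%N 0%N) * cmod (d 1%N 0%N)
   + cmod (c 2%N 0%N) * cmod (d 0%N 0%N) + cmod (c 0%N 0%N) * cmod (d 0%N 2%N)
   + cmod (c 0%N 1%N) * cmod (d 0%N 1%N) + cmod (c 0%N 2%N) * cmod (d 0%N 0%N))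
   + B * (cmod (c 0%N 0%N) * cmod (d 1%N 1%N) + cmod (c 1%N 0%N) * cmod (d 0%N 1%N)
   + cmod (c 0%N 1%N) * cmod (d 1%N 0%N) + cmod (c 1%N 1%N) * cmod (d 0%N 0%N)))).
  rewrite /hankel -!Normc.normcM; apply: le_trans (cmodD _ _) _.
  rewrite !(Normc.normcM _%:C) !cmod_real !ger0_norm//.
  apply: lerD; apply: ler_wpM2l => //.
    by do 5!(apply: le_trans (cmodD _ _) _; apply: lerD => //).
  by do 3!(apply: le_trans (cmodD _ _) _; apply: lerD => //).
apply: le_trans (hankel_bound_real _ _ _ _ _ _ _ _ _ _ A0 B0 AB AAB _ _) _;
  rewrite ?cmod_ge0//.
by rewrite ler_pM ?sqrtr_ge0// ler_wsqrtr// low_coef_norm2_le.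
Qed.

Lemma quartic_bound A B c d (P Q : R) : 0 <= A -> 0 <= B -> A + B <= 1 ->
  (forall i j, (i + j < 3)%N -> cmod (c i j) <= P) ->
  (forall i j, (i + j < 3)%N -> cmod (d i j) <= Q) ->
  cmod (quartic A B c d) <= 4 * (P * Q).
Proof.
move=> A0 B0 AB cP dQ.
have term i j k l : (i + j < 3)%N -> (k + l < 3)%N -> cmod (c i j * d k l) <= P * Q.
  by move=> ij kl; rewrite Normc.normcM ler_pM ?cmod_ge0 ?cP ?dQ.
have PQ0 : 0 <= P * Q by apply: le_trans (term 0%N 0%N 0%N 0%N isT isT); exact: cmod_ge0.
apply: (le_trans (y := A * (P * Q + P * Q) + B * (P * Q + P * Q + P * Q + P * Q))).
  apply: le_trans (cmodD _ _) _.
  rewrite !(Normc.normcM _%:C) !cmod_real !ger0_norm//.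
  apply: lerD; apply: ler_wpM2l => //.
    by apply: le_trans (cmodD _ _) _; apply: lerD; exact: term.
  by do 3?(apply: le_trans (cmodD _ _) _; apply: lerD); exact: term.
have := ler_wpM2r PQ0 AB; have := mulr_ge0 A0 PQ0; lra.
Qed.

(** Both polynomials are split at total degree [3].  The quadratic parts give the
Hankel form up to [r ^+ 2 * quartic]; every other product of parts contains a
tail of size [O(r ^+ 3)], and the division by [r ^+ 2] in [secdiff] leaves [O(r)]. *)
Lemma secdiff_tpoly A B r N c d : (3 <= N)%N -> 0 <= A -> 0 <= B -> A + B <= 1 ->
  A ^+ 2 + B ^+ 2 + A ^+ 2 <= 1 -> 0 < r -> r <= 2^-1 ->
  cmod (secdiff A B r (fun z1 z2 => tpoly N c z1 z2 * tpoly N d z1 z2)) <=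
  (1 + 3000 * r) * (L2norm (tpoly N c) * L2norm (tpoly N d)).
Proof.
move=> N3 A0 B0 AB AAB r0 r2.
have normE (e : nat -> nat -> C) : L2norm (tpoly N e) = Num.sqrt (coef_norm2 N e).
  by rewrite -L2norm_tpoly sqrtr_sqr ger0_norm ?L2norm_ge0.
set P := L2norm _; set Q := L2norm _.
have P0 : 0 <= P by exact: L2norm_ge0.
have Q0 : 0 <= Q by exact: L2norm_ge0.
have PQ0 : 0 <= P * Q by rewrite mulr_ge0.
have low (e : nat -> nat -> C) i j : (i + j < 3)%N -> cmod (e i j) <= L2norm (tpoly N e).
  move=> ij; rewrite normE.
  have iN : (i < N)%N by rewrite (leq_trans _ N3)// (leq_ltn_trans _ ij)// leq_addr.
  have jN : (j < N)%N by rewrite (leq_trans _ N3)// (leq_ltn_trans _ ij)// leq_addl.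
  exact: (cmod_coef_le e (Ordinal iN, Ordinal jN)).
have all_ (e : nat -> nat -> C) (u : 'I_N * 'I_N) : cmod (e u.1 u.2) <= L2norm (tpoly N e).
  by rewrite normE cmod_coef_le.
have inst z : z \in stencil r -> cmod z <= r.
  rewrite !inE => /or3P[] /eqP ->; first by rewrite Normc.normc0 ltW.
    by rewrite cmod_real gtr0_norm.
  by rewrite cmodN cmod_real gtr0_norm.
have r1 : r <= 1 by lra.
have r3 : r ^+ 3 <= 2^-1 ^+ 3 by rewrite lerXn2r// ?nnegrE ?invr_ge0// ltW.
rewrite -(subrK (secdiff A B r (fun z1 z2 => quad c z1 z2 * quad d z1 z2)) (secdiff _ _ _ _)).
rewrite secdiffB; apply: le_trans (cmodD _ _) _.
rewrite secdiff_quad ?lt0r_neq0//.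
have main := hankel_bound c d N3 A0 B0 AB AAB; rewrite -!normE -/P -/Q in main.
have quart := quartic_bound A0 B0 AB (low c) (low d); rewrite -/P -/Q in quart.
(* The constant is [32 * 10 + 6 * 32], from the bounds on the two products of a
   tail with a full polynomial or a quadratic part. *)
have err : cmod (secdiff A B r (fun z1 z2 => tpoly N c z1 z2 * tpoly N d z1 z2
     - quad c z1 z2 * quad d z1 z2)) <= 5 * (512 * (P * Q) * r ^+ 3) / r ^+ 2.
  apply: secdiff_bound => // z1 z2 /inst z1r /inst z2r.
  rewrite (tpoly_split c)// (tpoly_split d)//.
  set qc := quad c z1 z2; set qd := quad d z1 z2.
  set tc := tpoly _ _ _ _; set td := tpoly _ _ _ _.
  have qcP : cmod qc <= 6 * P by apply: quad_bound (low c); exact: le_trans r1.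
  have qdQ : cmod qd <= 6 * Q by apply: quad_bound (low d); exact: le_trans r1.
  have tcP : cmod tc <= 32 * P * r ^+ 3 by apply: tail_bound (all_ c) P0.
  have tdQ : cmod td <= 32 * Q * r ^+ 3 by apply: tail_bound (all_ d) Q0.
  have -> : (qc + tc) * (qd + td) - qc * qd = tc * (qd + td) + qc * td by ring.
  apply: le_trans (cmodD _ _) _; rewrite !Normc.normcM.
  have h1 : cmod (qd + td) <= 10 * Q.
    apply: le_trans (cmodD _ _) _; apply: le_trans (lerD qdQ tdQ) _.
    by have := ler_wpM2l Q0 r3; lra.
  apply: le_trans (lerD (ler_pM (cmod_ge0 _) (cmod_ge0 _) tcP h1)
    (ler_pM (cmod_ge0 _) (cmod_ge0 _) qcP tdQ)) _.
  by rewrite le_eqVlt; apply/orP; left; apply/eqP; ring.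
have {err}err : cmod (secdiff A B r (fun z1 z2 => tpoly N c z1 z2 * tpoly N d z1 z2
     - quad c z1 z2 * quad d z1 z2)) <= 2560 * r * (P * Q).
  apply: le_trans err _; rewrite le_eqVlt; apply/orP; left; apply/eqP.
  by field; exact: lt0r_neq0.
have rr : r ^+ 2 <= r by rewrite expr2 -[leRHS]mulr1 ler_wpM2l// ltW.
have quart' : cmod ((r ^+ 2)%:C * quartic A B c d) <= r * (4 * (P * Q)).
  rewrite Normc.normcM cmod_real ger0_norm ?sqr_ge0//.
  by apply: ler_pM; rewrite ?sqr_ge0 ?cmod_ge0.
apply: le_trans (lerD err (le_trans (cmodD _ _) (lerD main quart'))) _.
move: (P * Q) PQ0 => x x0.
by have := mulr_ge0 (ltW r0) x0; lra.
Qed.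

End PolynomialEstimate.

(** * Passage to the Hardy space and the lower bound for the cost *)

(** A limit [e --> 0] expressed without filters. *)
Lemma le_of_linear_error {R : realType} (x y D : R) :
  (forall e : R, 0 < e -> e <= 1 -> x <= y + D * e) -> x <= y.
Proof.
move=> xy; apply/ler_addgt0Pr => e e0.
(* This [k] satisfies both [k <= 1] and [`|D| * k <= e]. *)
pose k := e / (e + `|D|).
have k0 : 0 < k by rewrite divr_gt0// ltr_pwDl.
have k1 : k <= 1 by rewrite ler_pdivrMr ?ltr_pwDl// mul1r lerDl.
apply: le_trans (xy k k0 k1) _; rewrite lerD2l.
apply: (le_trans (y := `|D| * k)); first by rewrite ler_wpM2r ?ler_norm// ltW.
by rewrite mulrCA ler_piMr ?(ltW e0)// ler_pdivrMr ?ltr_pwDl// mul1r lerDr ltW.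
Qed.

Lemma uniform_constant {R : realType} (T : eqType) (s : seq T) (P : T -> R -> Prop) :
  (forall x k l, P x k -> k <= l -> P x l) ->
  (forall x, x \in s -> exists k, P x k) -> exists k, forall x, x \in s -> P x k.
Proof.
move=> Pm; elim: s => [|x s IH] Ps; first by exists 0.
have [k Pk] := Ps x (mem_head x s).
have [l Pl] : exists l, forall y, y \in s -> P y l.
  by apply: IH => y ys; apply: Ps; rewrite inE ys orbT.
exists (Num.max k l) => y; rewrite inE => /orP[/eqP->|ys].
  by apply: Pm Pk _; rewrite le_max lexx.
by apply: Pm (Pl y ys) _; rewrite le_max lexx orbT.
Qed.

Lemma near_all_seq (T : eqType) (s : seq T) (P : T -> nat -> Prop) :
  (forall x, x \in s -> \forall n \near \oo, P x n) ->
  \forall n \near \oo, forall x, x \in s -> P x n.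
Proof.
elim: s => [|x s IH] Ps; first exact: nearW.
have Px := Ps x (mem_head x s).
have {}IH : \forall n \near \oo, forall y, y \in s -> P y n.
  by apply: IH => y ys; apply: Ps; rewrite inE ys orbT.
near=> n => y; rewrite inE => /orP[/eqP->|].
  by near: n.
by move: y; near: n.
Unshelve. all: end_near.
Qed.

Section LowerBound.
Context {R : realType}.
Local Notation C := R[i].
Implicit Types (f g h : C -> C -> C) (A B r a : R).

Lemma stencil_bidisc r z1 z2 : 0 < r -> r <= 2^-1 ->
  z1 \in stencil r -> z2 \in stencil r -> in_bidisc z1 z2.
Proof.
move=> r0 r2.
have inst z : z \in stencil r -> cmod z < 1.
  rewrite !inE => /or3P[] /eqP ->; first by rewrite Normc.normc0.
    by rewrite cmod_real gtr0_norm//; lra.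
  by rewrite cmodN cmod_real gtr0_norm//; lra.
by move=> /inst ? /inst.
Qed.

(** Approximation of [g] and [h] by polynomials within [e], first in norm and then,
through [extension_close], at the nine points of the stencil with a common
constant [k]. *)
Lemma secdiff_H2 A B r g h : 0 <= A -> 0 <= B -> A + B <= 1 ->
  A ^+ 2 + B ^+ 2 + A ^+ 2 <= 1 -> 0 < r -> r <= 2^-1 -> in_H2 g -> in_H2 h ->
  cmod (secdiff A B r (fun z1 z2 => extension g z1 z2 * extension h z1 z2)) <=
  (1 + 3000 * r) * (L2norm g * L2norm h).
Proof.
move=> A0 B0 AB AAB r0 r2 [Lg dg] [Lh dh].
pose close f z (k : R) := cmod (extension f z.1 z.2) <= k /\
  forall N c (e : R), L2norm (fun w1 w2 => f w1 w2 - tpoly N c w1 w2) < e ->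
    cmod (extension f z.1 z.2 - tpoly N c z.1 z.2) <= k * e.
have closeW f z k l : close f z k -> k <= l -> close f z l.
  move=> [fk ck] kl; split; first exact: le_trans kl.
  move=> N c e fe; apply: le_trans (ck N c e fe) _; rewrite ler_wpM2r//.
  by apply: ltW; apply: le_lt_trans fe; exact: L2norm_ge0.
have closeE f z1 z2 : in_L2 f -> in_bidisc z1 z2 -> exists k, close f (z1, z2) k.
  move=> Lf zz; have [k ck] := extension_close Lf zz.
  exists (Num.max k (cmod (extension f z1 z2))); split; first by rewrite le_max lexx orbT.
  move=> N c e fe; apply: le_trans (ck N c e fe) _; rewrite ler_wpM2r ?le_max ?lexx//.
  by apply: ltW; apply: le_lt_trans fe; exact: L2norm_ge0.
have [k closek] : exists k, forall z, z \in [seq (z1, z2) | z1 <- stencil r, z2 <- stencil r] ->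
    close g z k /\ close h z k.
  apply: uniform_constant => [z k l [? ?] kl|]; first by split; apply: closeW kl.
  move=> z /allpairsP[[z1 z2] /= [z1r z2r ->]].
  have zz := stencil_bidisc r0 r2 z1r z2r.
  have [k gk] := closeE g z1 z2 Lg zz; have [l hl] := closeE h z1 z2 Lh zz.
  exists (Num.max k l); split; first by apply: closeW gk _; rewrite le_max lexx.
  by apply: closeW hl _; rewrite le_max lexx orbT.
have {closek}closek z1 z2 : z1 \in stencil r -> z2 \in stencil r ->
    close g (z1, z2) k /\ close h (z1, z2) k.
  by move=> z1r z2r; apply: closek; apply/allpairsP; exists (z1, z2).
have G0 := L2norm_ge0 g; have H0 := L2norm_ge0 h.
set G := L2norm g in G0 *; set H := L2norm h in H0 *.
apply: (@le_of_linear_error R _ _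
  ((1 + 3000 * r) * (2 * G + 2 * H + 4) + 5 * (3 * k ^+ 2) / r ^+ 2)) => e e0 e1.
have [p gp] := dg e e0; have [q hq] := dh e e0.
have [N1 pN] := poly2_tpoly p; have [N2 qN] := poly2_tpoly q.
pose N := maxn (maxn N1 N2) 3.
have N1N : (N1 <= N)%N by rewrite /N !leq_max leqnn.
have N2N : (N2 <= N)%N by rewrite /N !leq_max leqnn orbT.
have N3 : (3 <= N)%N by rewrite /N leq_max leqnn orbT.
rewrite (pN N N1N) in gp; rewrite (qN N N2N) in hq.
pose c (i j : nat) : C := (p`_j)`_i; pose d (i j : nat) : C := (q`_j)`_i.
rewrite -/c in gp; rewrite -/d in hq.
have main := secdiff_tpoly c d N3 A0 B0 AB AAB r0 r2.
(* On the stencil the products differ by at most [k * (k * e) + (k * e) * (2 * k)]. *)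
have err : cmod (secdiff A B r (fun z1 z2 => extension g z1 z2 * extension h z1 z2
    - tpoly N c z1 z2 * tpoly N d z1 z2)) <= 5 * (3 * k ^+ 2 * e) / r ^+ 2.
  apply: secdiff_bound => // z1 z2 z1r z2r.
  have [[Gk cg] [Hk ch]] := closek z1 z2 z1r z2r.
  rewrite -[(z1, z2).1]/z1 -[(z1, z2).2]/z2 in Gk Hk cg ch.
  have {}cg := cg N c e gp; have {}ch := ch N d e hq.
  move: cg ch Gk Hk.
  move: (extension g z1 z2) (extension h z1 z2) (tpoly N c z1 z2) (tpoly N d z1 z2).
  move=> u v u' v' uu' vv' uk vk.
  have k0 : 0 <= k by apply: le_trans uk; exact: cmod_ge0.
  have v'k : cmod v' <= 2 * k.
    rewrite -(subKr v v'); apply: le_trans (cmodB _ _) _.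
    have : k * e <= k by rewrite ler_piMr.
    lra.
  have -> : u * v - u' * v' = u * (v - v') + (u - u') * v' by ring.
  apply: le_trans (cmodD _ _) _; rewrite !Normc.normcM.
  apply: le_trans (lerD (ler_pM (cmod_ge0 _) (cmod_ge0 _) uk vv')
    (ler_pM (cmod_ge0 _) (cmod_ge0 _) uu' v'k)) _.
  by rewrite le_eqVlt; apply/orP; left; apply/eqP; ring.
rewrite -secdiffB in err.
have pG := L2norm_close Lg e0 gp; have qH := L2norm_close Lh e0 hq.
rewrite -/G in pG; rewrite -/H in qH.
have prod : L2norm (tpoly N c) * L2norm (tpoly N d) <= G * H + e * (2 * G + 2 * H + 4).
  apply: le_trans (ler_pM (L2norm_ge0 _) (L2norm_ge0 _) pG qH) _.
  have : e * e <= e by rewrite ler_piMr// ltW.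
  rewrite !mulr2n; move: G H G0 H0 {pG qH} => x y; lra.
have r3 : 0 <= 1 + 3000 * r by lra.
rewrite -(subrK (secdiff A B r (fun z1 z2 => tpoly N c z1 z2 * tpoly N d z1 z2)) (secdiff _ _ _ _)).
apply: le_trans (cmodD _ _) _.
apply: le_trans (lerD err (le_trans main (ler_wpM2l r3 prod))) _.
by rewrite le_eqVlt; apply/orP; left; apply/eqP; field; rewrite lt0r_neq0.
Qed.

(** At a partial sum of the weak factorization that is within [e] of [f] on the
stencil, the bound for the individual products is added up. *)
Lemma secdiff_le_cost A B r f (g h : nat -> C -> C -> C) : 0 <= A -> 0 <= B -> A + B <= 1 ->
  A ^+ 2 + B ^+ 2 + A ^+ 2 <= 1 -> 0 < r -> r <= 2^-1 ->
  weak_factorization f g h ->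
  cmod (secdiff A B r f) <= (1 + 3000 * r) * fine (cost g h).
Proof.
move=> A0 B0 AB AAB r0 r2 [gH hH costoo fgh].
have r3 : 0 <= 1 + 3000 * r by lra.
have term0 j : (0 <= (L2norm (g j) * L2norm (h j))%:E)%E.
  by rewrite lee_fin mulr_ge0 ?L2norm_ge0.
have cost0 : (0 <= cost g h)%E by exact: nneseries_ge0.
have costE : (fine (cost g h))%:E = cost g h by rewrite fineK// ge0_fin_numE.
have partial n : \sum_(0 <= j < n) L2norm (g j) * L2norm (h j) <= fine (cost g h).
  rewrite -lee_fin costE -sumEFin; exact: nneseries_lim_ge.
apply: (@le_of_linear_error R _ _ (5 / r ^+ 2)) => e e0 _.
have : \forall n \near \oo, forall z, z \in [seq (z1, z2) | z1 <- stencil r, z2 <- stencil r] ->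
    Normc.normc (\sum_(0 <= j < n) extension (g j) z.1 z.2 * extension (h j) z.1 z.2
       - f z.1 z.2) <= e.
  apply: near_all_seq => z /allpairsP[[z1 z2] /= [z1r z2r ->]] /=.
  have := fgh z1 z2 (stencil_bidisc r0 r2 z1r z2r).
  move=> /cvgrPdist_le /(_ e e0); apply: filterS => n.
  by rewrite sub0r normrN ger0_norm ?cmod_ge0.
move=> [n _ /(_ n (leqnn n)) closen].
rewrite -(subrK (secdiff A B r (fun z1 z2 =>
  \sum_(0 <= j < n) extension (g j) z1 z2 * extension (h j) z1 z2)) (secdiff _ _ _ f)).
rewrite secdiffB addrC; apply: le_trans (cmodD _ _) _; apply: lerD.
  rewrite secdiff_sum; apply: le_trans (cmod_sum _ _ _) _.
  apply: (le_trans (y := \sum_(0 <= j < n) (1 + 3000 * r) * (L2norm (g j) * L2norm (h j)))).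
    by apply: ler_sum => j _; exact: secdiff_H2.
  by rewrite -mulr_sumr; exact: (ler_wpM2l r3 (partial n)).
have -> : 5 / r ^+ 2 * e = 5 * e / r ^+ 2 by ring.
apply: secdiff_bound => // z1 z2 z1r z2r.
rewrite -cmodN opprB.
by apply: (closen (z1, z2)); apply/allpairsP; exists (z1, z2).
Qed.

Lemma secdiff_phi A B r a : r != 0 -> secdiff A B r (phi a) = (2 * A + B * a)%:C.
Proof.
move=> r0; have rC : r%:C != 0 by rewrite eq_complex/= eqxx andbT.
rewrite /secdiff /phi !(rmorphD, rmorphM)/= !fmorphV/= !rmorphM/= !rmorph_nat.
by field.
Qed.

Lemma le_cost_phi A B a (g h : nat -> C -> C -> C) : 0 <= A -> 0 <= B -> A + B <= 1 ->
  A ^+ 2 + B ^+ 2 + A ^+ 2 <= 1 -> weak_factorization (phi a) g h ->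
  ((2 * A + B * a)%:E <= cost g h)%E.
Proof.
move=> A0 B0 AB AAB fgh; have [_ _ costoo _] := fgh.
have cost0 : (0 <= cost g h)%E.
  by apply: nneseries_ge0 => j _ _; rewrite lee_fin mulr_ge0 ?L2norm_ge0.
have costE : (fine (cost g h))%:E = cost g h by rewrite fineK// ge0_fin_numE.
rewrite -costE lee_fin; set K := fine _.
apply: (@le_of_linear_error R _ _ (1500 * K)) => e e0 e1.
have r0 : 0 < e / 2 by rewrite divr_gt0.
have r2 : e / 2 <= 2^-1 by rewrite -[leRHS]mul1r ler_wpM2r.
have := secdiff_le_cost A0 B0 AB AAB r0 r2 fgh.
rewrite secdiff_phi ?lt0r_neq0// cmod_real => /(le_trans (ler_norm _)).
by rewrite -/K; move: K => K; lra.
Qed.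

(** A dual certificate: the lower bound for all weak factorizations is attained. *)
Lemma optimal_phi A B a (g h : nat -> C -> C -> C) : 0 <= A -> 0 <= B -> A + B <= 1 ->
  A ^+ 2 + B ^+ 2 + A ^+ 2 <= 1 -> weak_factorization (phi a) g h ->
  cost g h = (2 * A + B * a)%:E -> optimal (phi a) g h.
Proof.
move=> A0 B0 AB AAB fgh costE; split => //; apply/eqP; rewrite eq_le; apply/andP; split.
  apply/ereal_infP => _ [g' [h' [fgh' ->]]].
  by rewrite costE; exact: le_cost_phi.
by apply: ereal_inf_lbound; exists g, h.
Qed.

End LowerBound.

(** * Finite weak factorizations and quadratic polynomials *)

Section Factorizations.
Context {R : realType}.
Local Notation C := R[i].
Implicit Types (f g h : C -> C -> C).

Lemma zero_tpoly : (fun _ _ => 0) = tpoly 0 (fun _ _ => 0) :> (C -> C -> C).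
Proof.
by apply/funext => z1; apply/funext => z2; rewrite /tpoly big_pred0// => -[[]].
Qed.

Lemma L2norm0 : L2norm (fun _ _ => 0 : C) = 0.
Proof.
rewrite zero_tpoly; apply/eqP; rewrite -sqrf_eq0 L2norm_tpoly.
by rewrite /coef_norm2 big_pred0// => -[[]].
Qed.

Lemma in_H2_finite_family (s : seq (C -> C -> C)) :
  (forall j, (j < size s)%N -> in_H2 (finite_family s j)) ->
  forall j, in_H2 (finite_family s j).
Proof.
move=> sH j; have [/sH//|js] := ltnP j (size s).
rewrite /finite_family nth_default// zero_tpoly; exact: in_H2_tpoly.
Qed.

(** The terms beyond the length of [s] vanish. *)
Lemma cost_finite_family (s t : seq (C -> C -> C)) :
  cost (finite_family s) (finite_family t) =
  (\sum_(0 <= j < size s) L2norm (finite_family s j) * L2norm (finite_family t j))%:E.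
Proof.
rewrite /cost (nneseries_split 0 (size s)); last first.
  by move=> j _; rewrite lee_fin mulr_ge0 ?L2norm_ge0.
rewrite add0n eseries0 ?adde0 ?sumEFin// => j js _.
by rewrite {1}/finite_family nth_default// L2norm0 mul0r.
Qed.

Lemma weak_factorization_finite_family f (s t : seq (C -> C -> C)) :
  (forall j, (j < size s)%N -> in_H2 (finite_family s j)) ->
  (forall j, (j < size t)%N -> in_H2 (finite_family t j)) ->
  (forall z1 z2, in_bidisc z1 z2 -> f z1 z2 = \sum_(0 <= j < size s)
     extension (finite_family s j) z1 z2 * extension (finite_family t j) z1 z2) ->
  weak_factorization f (finite_family s) (finite_family t).
Proof.
move=> sH tH fE; split; [exact: in_H2_finite_family..| |].
  by rewrite cost_finite_family ltry.
move=> z1 z2 zz; apply: cvg_near_cst.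
near=> n; have sn : (size s <= n)%N by near: n; exact: nbhs_infty_ge.
have tail0 : \sum_(size s <= j < n)
    extension (finite_family s j) z1 z2 * extension (finite_family t j) z1 z2 = 0.
  rewrite big_nat_cond big1 // => j /andP[/andP[sj _] _].
  by rewrite {1}/finite_family nth_default// zero_tpoly extension_tpoly//
    -zero_tpoly mul0r.
by rewrite (big_cat_nat (leq0n _) sn)/= tail0 addr0 -fE// subrr Normc.normc0.
Unshelve. all: end_near.
Qed.

(** Coefficients of a polynomial of degree two, in the order of the total degree. *)
Definition coef6 (a00 a10 a01 a20 a11 a02 : R) (i j : nat) : C :=
  match i, j with
  | 0%N, 0%N => a00%:C | 1%N, 0%N => a10%:C | 0%N, 1%N => a01%:C
  | 2%N, 0%N => a20%:C | 1%N, 1%N => a11%:C | 0%N, 2%N => a02%:C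
  | _, _ => 0
  end.

Lemma quadratic_H2 (a00 a10 a01 a20 a11 a02 : R) f :
  (forall z1 z2, f z1 z2 = a00%:C + a10%:C * z1 + a01%:C * z2 + a20%:C * z1 ^+ 2
     + a11%:C * (z1 * z2) + a02%:C * z2 ^+ 2) ->
  [/\ in_H2 f, (forall z1 z2, in_bidisc z1 z2 -> extension f z1 z2 = f z1 z2) &
    L2norm f = Num.sqrt (a00 ^+ 2 + a10 ^+ 2 + a01 ^+ 2 + a20 ^+ 2 + a11 ^+ 2 + a02 ^+ 2)].
Proof.
move=> fE; have -> : f = tpoly 3 (coef6 a00 a10 a01 a20 a11 a02).
  apply/funext => z1; apply/funext => z2.
  by rewrite fE tpoly3E /quad /= !mul0r !addr0.
split; [exact: in_H2_tpoly|by move=> z1 z2 zz; exact: extension_tpoly|].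
have := L2norm_tpoly 3 (coef6 a00 a10 a01 a20 a11 a02); rewrite coef_norm2_3E.
rewrite -[X in _ = X]/(cmod a00%:C ^+ 2 + cmod a10%:C ^+ 2 + cmod a01%:C ^+ 2
  + cmod a20%:C ^+ 2 + cmod a11%:C ^+ 2 + cmod a02%:C ^+ 2
  + (cmod (0 : C) ^+ 2 + cmod (0 : C) ^+ 2 + cmod (0 : C) ^+ 2)).
rewrite Normc.normc0 !cmod_real expr0n/= !addr0 !real_normK ?num_real// => <-.
by rewrite sqrtr_sqr ger0_norm ?L2norm_ge0.
Qed.

End Factorizations.

(** * The optimal factorizations *)

Local Close Scope classical_set_scope.

Theorem mainTheorem6 (R : realType) (a : R) (ha : 0 <= a) :
  [/\ a <= 1 / 2 ->
        optimal (phi a)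
          (finite_family [:: phi a])
          (finite_family [:: (fun _ _ => 1)]),
      1 / 2 < a -> a < 2 ->
        optimal (phi a)
          (finite_family
             [:: (fun z1 z2 => (2 / 3 * (a - 1 / 2))%:C * (z1 + z2));
                 (fun z1 z2 => (2 / 3 * (2 - a))%:C
                               * (z1 ^+ 2 + z1 * z2 / 2 + z2 ^+ 2))])
          (finite_family
             [:: (fun z1 z2 => z1 + z2);
                 (fun _ _ => 1)]) &
      2 < a ->
        optimal (phi a)
          (finite_family
             [:: (fun z1 z2 => z1 + ((a + Num.sqrt (a ^+ 2 - 4)) / 2)%:C * z2)])
          (finite_family
             [:: (fun z1 z2 => z1 + ((a - Num.sqrt (a ^+ 2 - 4)) / 2)%:C * z2)])].
Proof.
have [H1 E1 N1] : [/\ in_H2 (fun _ _ => 1 : R[i]),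
    (forall z1 z2 : R[i], in_bidisc z1 z2 -> extension (fun _ _ => 1) z1 z2 = 1)
    & L2norm (fun _ _ => 1 : R[i]) = 1].
  have [H E ->] := @quadratic_H2 R 1 0 0 0 0 0 (fun _ _ => 1)
    (fun z1 z2 => ltac:(rewrite !rmorph0 rmorph1; ring)).
  by split => //; rewrite expr0n expr1n /= !addr0 sqrtr1.
split.
- move=> a2.
  have [Hp Ep Np] := @quadratic_H2 R 0 0 0 1 a 1 (phi a)
    (fun z1 z2 => ltac:(rewrite /phi !rmorph0 rmorph1; ring)).
  set s := Num.sqrt _ in Np.
  have ss : s ^+ 2 = 2 + a ^+ 2 by rewrite sqr_sqrtr ?addr_ge0 ?sqr_ge0//; ring.
  have s0 : 0 < s by rewrite lt_def sqrtr_ge0 andbT -sqrf_eq0 ss gt_eqF// ltr_wpDr ?sqr_ge0.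
  apply: (@optimal_phi R s^-1 (a / s)).
  + by rewrite invr_ge0 ltW.
  + by rewrite divr_ge0// ltW.
  + rewrite -{1}(mul1r s^-1) -mulrDl ler_pdivrMr// mul1r.
    rewrite -(@ler_pXn2r _ 2%N)// ?nnegrE ?addr_ge0// ?(ltW s0)// ss.
    nra.
  + rewrite le_eqVlt; apply/orP; left; apply/eqP.
    have -> : s^-1 ^+ 2 + (a / s) ^+ 2 + s^-1 ^+ 2 = (2 + a ^+ 2) / s ^+ 2.
      by field; rewrite lt0r_neq0.
    by rewrite -ss divff// sqrf_eq0 lt0r_neq0.
  + apply: weak_factorization_finite_family => [[]|[]|z1 z2 zz]//.
    by rewrite big_nat1 /finite_family /= Ep// E1// mulr1.
  + rewrite cost_finite_family big_nat1 /finite_family /= Np N1 mulr1; congr EFin.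
    have -> : 2 / s + a / s * a = (2 + a ^+ 2) / s by field; rewrite lt0r_neq0.
    by rewrite -ss expr2 mulfK// lt0r_neq0.
- move=> a1 a2; set b : R := 2 / 3 * (a - 1 / 2); set c : R := 2 / 3 * (2 - a).
  have b0 : 0 <= b by rewrite /b; lra.
  have c0 : 0 <= c by rewrite /c; lra.
  have [Hs Es Ns] := @quadratic_H2 R 0 1 1 0 0 0 (fun z1 z2 => z1 + z2)
    (fun z1 z2 => ltac:(rewrite !rmorph0 rmorph1; ring)).
  have [Hb Eb Nb] := @quadratic_H2 R 0 b b 0 0 0 (fun z1 z2 => b%:C * (z1 + z2))
    (fun z1 z2 => ltac:(rewrite !rmorph0; ring)).
  have half : (c / 2)%:C = c%:C / 2 :> R[i] by rewrite rmorphM fmorphV rmorph_nat.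
  have [Hc Ec Nc] := @quadratic_H2 R 0 0 0 c (c / 2) c
    (fun z1 z2 => c%:C * (z1 ^+ 2 + z1 * z2 / 2 + z2 ^+ 2))
    (fun z1 z2 => ltac:(rewrite !rmorph0 half; ring)).
  apply: (@optimal_phi R (2 / 3) (1 / 3)); [lra|lra|lra|lra| |].
  + apply: weak_factorization_finite_family => [[|[]]|[|[]]|z1 z2 zz]//.
    rewrite big_nat_recl// big_nat1 /finite_family /= Eb// Es// Ec// E1// mulr1.
    rewrite /phi /b /c !(rmorphB, rmorphM) /= !fmorphV !rmorph_nat.
    by field.
  + rewrite cost_finite_family big_nat_recl// big_nat1 /finite_family /=.
    rewrite Nb Ns Nc N1 mulr1; congr EFin.
    rewrite -sqrtrM; last by rewrite !addr_ge0 ?sqr_ge0.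
    rewrite [X in Num.sqrt X + _](_ : _ = (2 * b) ^+ 2); last by ring.
    rewrite [X in _ + Num.sqrt X](_ : _ = (3 / 2 * c) ^+ 2); last by field.
    have b2 : 0 <= 2 * b by exact: mulr_ge0.
    have c2 : 0 <= 3 / 2 * c by apply: mulr_ge0 => //; exact: divr_ge0.
    rewrite !sqrtr_sqr (ger0_norm b2) (ger0_norm c2).
    by rewrite /b /c; field.
- move=> a2; set t := Num.sqrt _; set p := (a + t) / 2; set q := (a - t) / 2.
  have tt : t ^+ 2 = a ^+ 2 - 4 by rewrite sqr_sqrtr//; nra.
  have pq : p * q = 1.
    rewrite (_ : p * q = (a ^+ 2 - t ^+ 2) / 4); last by rewrite /p /q; field.
    by rewrite tt; field.
  have pDq : p + q = a by rewrite /p /q; field.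
  clearbody p q; clear t tt.
  have [Hp Ep Np] := @quadratic_H2 R 0 1 p 0 0 0 (fun z1 z2 => z1 + p%:C * z2)
    (fun z1 z2 => ltac:(rewrite !rmorph0 rmorph1; ring)).
  have [Hq Eq Nq] := @quadratic_H2 R 0 1 q 0 0 0 (fun z1 z2 => z1 + q%:C * z2)
    (fun z1 z2 => ltac:(rewrite !rmorph0 rmorph1; ring)).
  apply: (@optimal_phi R 0 1); [lra|lra|lra|lra| |].
  + apply: weak_factorization_finite_family => [[]|[]|z1 z2 zz]//.
    rewrite big_nat1 /finite_family /= Ep// Eq//.
    have -> : (z1 + p%:C * z2) * (z1 + q%:C * z2)
      = z1 ^+ 2 + (p + q)%:C * z1 * z2 + (p * q)%:C * z2 ^+ 2.
      by rewrite rmorphD rmorphM /=; ring.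
    by rewrite pDq pq mul1r.
  + rewrite cost_finite_family big_nat1 /finite_family /= Np Nq; congr EFin.
    rewrite -sqrtrM; last by rewrite !addr_ge0 ?sqr_ge0.
    rewrite [X in Num.sqrt X](_ : _ = (p + q) ^+ 2 - 2 * (p * q) + 1 + (p * q) ^+ 2); last by ring.
    rewrite pDq pq [X in Num.sqrt X](_ : _ = a ^+ 2); last by ring.
    by rewrite sqrtr_sqr ger0_norm//; ring.
Qed.
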